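(* Let $d\ge 1$ be an integer, $\alpha\in(0,d)$, $1\le a<b\le d/\alpha$ and $\psi\in\Psi(a,b)$. Define $$\zeta_{\alpha,d}(q)=\left[\frac{q^2}{q-d/(d-\alpha)}\right]^{1-\alpha/d}\,\psi\!\left(\frac{dq}{d+\alpha q}\right),$$ for those $q\in(d/(d-\alpha),\infty)$ such that $dq/(d+\alpha q)\in(a,b)$. Then there is a constant $C(\alpha,d,\psi)\in(0,\infty)$ such that for every $f\in G(\psi)$, $$\|I_\alpha f\|G(\zeta_{\alpha,d})\le C(\alpha,d,\psi)\,\|f\|G(\psi).$$
   Context: For measurable $f:\mathbb R^d\to\mathbb R$, $|f|_p=\left(\int_{\mathbb R^d}|f(x)|^p\,dx\right)^{1/p}$. The Riesz potential is $I_\alpha f(x)=\int_{\mathbb R^d}\frac{f(y)\,dy}{|x-y|^{d-\alpha}}$, with $|\cdot|$ the Euclidean norm. For $1\le a<b\le\infty$, $\Psi(a,b)$ is the set of continuous positive functions $\psi:(a,b)\to(0,\infty)$ for which the limits $\psi(a+0),\psi(b-0)$ exist (finite or infinite), with $\inf_{p\in(a,b)}\psi(p)>0$ and $\min\{\psi(a+0),\psi(b-0)\}>0$. The Bilateral Grand Lebesgue Space $G(\psi)=G(\psi;a,b)$ consists of all measurable $f:\mathbb R^d\to\mathbb R$ with finite norm $$\|f\|G(\psi)=\sup_{p\in(a,b)}\frac{|f|_p}{\psi(p)}.$$ The norm $\|\cdot\|G(\zeta_{\alpha,d})$ is defined in the same way, the supremum being over the $q$ for which $\zeta_{\alpha,d}(q)$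 is defined. The map $p\mapsto q(p)=pd/(d-\alpha p)$ (i.e. $1/q=1/p-\alpha/d$) is a bijection from $(1,d/\alpha)$ onto $(d/(d-\alpha),\infty)$ with inverse $p(q)=dq/(d+\alpha q)$. *)

(* Defs.v *)
From HB Require Import structures.
From mathcomp Require Import all_boot all_order all_algebra.
From mathcomp Require Import all_classical all_reals all_analysis.
Set Implicit Arguments.
Unset Strict Implicit.
Unset Printing Implicit Defensive.
Import Order.TTheory GRing.Theory Num.Theory.
Import numFieldNormedType.Exports.
Local Open Scope classical_set_scope.
Local Open Scope ring_scope.

(* Inference of a sigma-finite structure on m1 \x m2 from those of m1 and m2 fails
   (the instance for subprobabilities takes precedence), hence this lemma. *)
Lemma sigma_finite_product d1 d2 (T1 : measurableType d1)
    (T2 : measurableType d2) (R : realType)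
    (m1 : {sigma_finite_measure set T1 -> \bar R})
    (m2 : {sigma_finite_measure set T2 -> \bar R}) :
  sigma_finite setT (m1 \x m2)%E.
Proof.
have /sigma_finiteP[F [TF ndF Foo]] := sigma_finiteT m1.
have /sigma_finiteP[G [TG ndG Goo]] := sigma_finiteT m2.
exists (fun n => F n `*` G n).
  rewrite -setXTT TF TG predeqE => -[x y]; split.
    move=> [/= [n _ Fnx] [k _ Gky]]; exists (maxn n k) => //; split.
    - by move: x Fnx; exact/subsetPset/ndF/leq_maxl.
    - by move: y Gky; exact/subsetPset/ndG/leq_maxr.
  by move=> [n _ []/= ? ?]; split; exists n.
move=> k; have [? ?] := Foo k; have [? ?] := Goo k.
split; first exact: measurableX.
by rewrite product_measure1E// lte_mul_pinfty// ge0_fin_numE.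
Qed.

Section borel_lebesgue_step.
Context (R : realType) (n : nat).
Variable mu : {sigma_finite_measure set (n.-tuple (measurableTypeR R)) -> \bar R}.
Local Open Scope ereal_scope.

Definition tuple_of_pair (x : measurableTypeR R * n.-tuple (measurableTypeR R)) :
  n.+1.-tuple (measurableTypeR R) := [tuple of x.1 :: x.2].

Lemma measurable_tuple_of_pair : measurable_fun [set: _] tuple_of_pair.
Proof. exact: (measurable_cons measurable_fst measurable_snd). Qed.

Lemma measurable_tuple_of_pair_preimage A :
  measurable A -> measurable (tuple_of_pair @^-1` A).
Proof. by rewrite -[X in _ -> measurable X]setTI; exact: measurable_tuple_of_pair. Qed.

Definition borel_lebesgue_step : set (n.+1.-tuple (measurableTypeR R)) -> \bar R :=
  pushforward (@lebesgue_measure R \x mu) tuple_of_pair.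

Let step0 : borel_lebesgue_step set0 = 0.
Proof. by rewrite /borel_lebesgue_step /pushforward preimage_set0 measure0. Qed.

Let step_ge0 A : 0 <= borel_lebesgue_step A.
Proof. by rewrite /borel_lebesgue_step /pushforward measure_ge0. Qed.

Let step_sigma_additive : semi_sigma_additive borel_lebesgue_step.
Proof.
move=> F mF tF mUF; rewrite /borel_lebesgue_step /pushforward preimage_bigcup.
apply: measure_semi_sigma_additive.
- by move=> i; exact: measurable_tuple_of_pair_preimage.
- apply/trivIsetP => /= i j _ _ ij; rewrite -preimage_setI.
  by move/trivIsetP : tF => /(_ _ _ _ _ ij) ->//; rewrite preimage_set0.
- by rewrite -preimage_bigcup; exact: measurable_tuple_of_pair_preimage.
Qed.

HB.instance Definition _ := isMeasure.Build _ _ _ borel_lebesgue_step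
  step0 step_ge0 step_sigma_additive.

Let step_sigma_finite : sigma_finite setT borel_lebesgue_step.
Proof.
have [F TF Foo] := sigma_finite_product (@lebesgue_measure R) mu.
pose g (t : n.+1.-tuple (measurableTypeR R)) := (thead t, [tuple of behead t]).
have gK : cancel tuple_of_pair g.
  by case=> x t; rewrite /g /= theadE; congr pair; exact/val_inj.
have mg : measurable_fun setT g.
  apply: measurable_fun_pair; first exact: (measurable_tnth ord0).
  exact: measurable_behead.
exists (fun i => g @^-1` F i).
  by rewrite -preimage_bigcup -TF preimage_setT.
move=> i; have [mF Fioo] := Foo i; split.
  by rewrite -[X in measurable X]setTI; exact: mg.
rewrite /borel_lebesgue_step /pushforward -comp_preimage.
by rewrite (_ : g \o tuple_of_pair = id)//; exact/funext.
Qed.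

HB.instance Definition _ := Measure_isSigmaFinite.Build _ _ _
  borel_lebesgue_step step_sigma_finite.

End borel_lebesgue_step.

(* Lebesgue measure on the Borel (= product) sigma-algebra of R^d, built as the
   d-fold product of the one-dimensional Lebesgue measure. *)
Fixpoint borel_lebesgue (R : realType) (d : nat) :
    {sigma_finite_measure set (d.-tuple (measurableTypeR R)) -> \bar R} :=
  match d with
  | 0 => \d_([tuple] : 0.-tuple (measurableTypeR R))
  | n.+1 => borel_lebesgue_step (borel_lebesgue R n)
  end.

(* R^d with the sigma-algebra of Lebesgue-measurable sets, i.e. the sets that are
   Caratheodory-measurable for the outer measure of borel_lebesgue; an element
   of euclid R d is a d-tuple of reals. *)
Definition euclid (R : realType) (d : nat) : measurableType _ :=
  caratheodory_type (borel_lebesgue R d)^*%mu.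

Definition lebesgue (R : realType) (d : nat) : set (euclid R d) -> \bar R :=
  @completed_measure_extension _ _ _ (borel_lebesgue R d).

HB.instance Definition _ (R : realType) (d : nat) :=
  Measure.on (@lebesgue R d).

Lemma sigma_finite_lebesgue (R : realType) (d : nat) :
  sigma_finite setT (@lebesgue R d).
Proof. exact/completed_measure_extension_sigma_finite/sigma_finiteT. Qed.

HB.instance Definition _ (R : realType) (d : nat) :=
  Measure_isSigmaFinite.Build _ _ _ (@lebesgue R d)
    (@sigma_finite_lebesgue R d).

Section grand_lebesgue.
Context (R : realType) (d : nat).

Definition coord (x : euclid R d) (i : 'I_d) : R :=
  @tnth d R (x : d.-tuple R) i.

Definition edist (x y : euclid R d) : R :=
  Num.sqrt (\sum_(i < d) (coord x i - coord y i) ^+ 2).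

(* At y = x the integrand takes the junk value f y / 0 = 0; this is immaterial,
   since singletons are null when 0 < d. *)
Definition riesz (alpha : R) (f : euclid R d -> R) (x : euclid R d) : \bar R :=
  (\int[@lebesgue R d]_y (f y / edist x y `^ (d%:R - alpha))%:E)%E.

(* The norm of G(psi), the supremum being over the exponents p \in D. *)
Definition GLnorm (D : set R) (psi : R -> R) (f : euclid R d -> \bar R) :
    \bar R :=
  ereal_sup [set ('N[@lebesgue R d]_p%:E[f] * ((psi p)^-1)%:E)%E | p in D].

Definition GL (D : set R) (psi : R -> R) : set (euclid R d -> R) :=
  [set f | measurable_fun [set: euclid R d] f /\
           (GLnorm D psi (EFin \o f) < +oo)%E].

End grand_lebesgue.

(* The class Psi(a, b) for a finite right endpoint b; psi is a total function of
   which only the restriction to ]a, b[ matters. *)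
Definition Psi (R : realType) (a b : R) : set (R -> R) :=
  [set psi : R -> R | [/\ {in `]a, b[, continuous psi},
    {in `]a, b[, forall p, 0 < psi p},
    0 < inf (psi @` `]a, b[) &
    exists la lb : \bar R,
      [/\ (psi p)%:E @[p --> a^'+] --> la,
          (psi p)%:E @[p --> b^'-] --> lb &
          (0 < Order.min la lb)%E]]].

Section zeta.
Context (R : realType) (d : nat) (alpha : R).

Definition zeta (psi : R -> R) (q : R) : R :=
  (q ^+ 2 / (q - d%:R / (d%:R - alpha))) `^ (1 - alpha / d%:R)
  * psi (d%:R * q / (d%:R + alpha * q)).

Definition zeta_dom (a b : R) : set R :=
  [set q | d%:R / (d%:R - alpha) < q /\
           a < d%:R * q / (d%:R + alpha * q) < b].

End zeta.

(* Main.v *)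
Require Import Defs.
From mathcomp Require Import all_boot all_order all_algebra.
From mathcomp Require Import all_classical all_reals all_analysis.
From mathcomp Require Import measurable_realfun ring lra.
Set Implicit Arguments.
Unset Strict Implicit.
Unset Printing Implicit Defensive.
Import Order.TTheory GRing.Theory Num.Theory.
Import numFieldNormedType.Exports.
Local Open Scope classical_set_scope.
Local Open Scope ring_scope.

(* Hedberg's argument.  Passing to the sup distance rho only increases the kernel, and rho-balls are
   cubes.  Splitting the integral defining I_alpha f (x) at distance delta, dyadic annuli bound the
   near part by delta^alpha times a maximal function M of f, and Hoelder's inequality bounds the far
   part by q^(1/p') delta^(-d/q) |f|_p.  Optimising in delta,
     I_alpha f <= C q^(1/p') |f|_p^(alpha p / d) M^(p/q),
   and the strong (p, p) bound for M (Vitali covering and dyadic interpolation) costs p'^(1/q).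
   Since 1/p' and 1/q are at most 1 - alpha/d, and q^2 / (q - d/(d-alpha)) = q p' (d-alpha)/d,
   the product of the two constants is absorbed by zeta. *)

(** The factor [psi p] occurs on both sides at corresponding exponents, so everything reduces to
    bounding the norm of the potential from L^p to L^q by the power factor of [zeta], with one
    constant for all p at once. Hence no constant depending on p may be lost: each geometric series
    of ratio 2^(-s) keeps its factor 1/(1 - 2^(-s)), which blows up only like 1/s. The exponents
    that degenerate are s = p - 1 in the maximal inequality (p near 1) and s = d p'/q in the far
    part (q large); they produce the factors p' and q. Measurability shapes the rest. The maximal
    function is reached through countable data only: balls with centres in a dense sequence and
    rational radii, and dyadic levels. The potential, whose measurability in x is not established,
    is handled by monotonicity of the integral alone. The argument runs in an abstract space whose
    balls of radius r have measure w r^n; cubes give w = 2^d and n = d. *)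

Section real_estimates.
Context (R : realType).
Implicit Types c s v x : R.

Lemma powR2_gt1 s : 0 < s -> 1 < 2 `^ s :> R.
Proof.
move=> s0; have := @gt0_ltr_powR R s s0 1 2; rewrite powR1; apply; rewrite ?nnegrE; lra.
Qed.

Lemma powR2N_lt1 s : 0 < s -> 2 `^ (- s) < 1 :> R.
Proof. by move=> s0; rewrite powRN invf_lt1 ?powR2_gt1// powR_gt0. Qed.

(** This is 2^s = exp(s ln 2) >= 1 + s ln 2, rearranged. It turns the factor of a geometric series
    into the explicit rate 1/s for small s. *)
Lemma inv_1BpowR2N_le s : 0 < s -> (1 - 2 `^ (- s))^-1 <= 1 + (s * ln 2)^-1.
Proof.
move=> s0; have l2 : 0 < ln 2 :> R by rewrite ln_gt0//; lra.
have sl : 0 < s * ln 2 by rewrite mulr_gt0.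
have h : 2 `^ (- s) <= (1 + s * ln 2)^-1 :> R.
  rewrite powRN lef_pV2 ?posrE ?powR_gt0//; last by lra.
  by rewrite /powR ifF; [exact: expR_ge1Dx|apply/eqP; lra].
have -> : 1 + (s * ln 2)^-1 = (1 - (1 + s * ln 2)^-1)^-1 by field; apply/and3P; split; lra.
have h1 : (1 + s * ln 2)^-1 < 1 by rewrite invf_lt1; lra.
by rewrite lef_pV2 ?posrE; [lra|lra|lra].
Qed.

Lemma sum_geometric_le c s k : 0 < c -> 0 < s ->
  \sum_(i < k) (c * 2 ^+ i) `^ s <= (c * 2 ^+ k) `^ s / (2 `^ s - 1).
Proof.
move=> c0 s0; have b1 := powR2_gt1 s0.
have E i : (c * 2 ^+ i) `^ s = c `^ s * (2 `^ s) ^+ i.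
  rewrite powRM ?exprn_ge0//; last lra.
  by rewrite -powR_mulrn; [rewrite powRAC powR_mulrn ?powR_ge0|lra].
under eq_bigr do rewrite E.
rewrite E -big_distrr/= -mulrA ler_wpM2l ?powR_ge0//.
rewrite ler_pdivlMr; last by lra.
by rewrite mulrC -subrX1; lra.
Qed.

Lemma sum_geometric_below_le c s v k : 0 < c -> 0 < s -> 0 <= v ->
  \sum_(i < k | c * 2 ^+ i < v) (c * 2 ^+ i) `^ s <= v `^ s / (1 - 2 `^ (- s)).
Proof.
move=> c0 s0 v0; have b1 := powR2_gt1 s0; have b2 := powR2N_lt1 s0.
elim: k => [|k IH].
  by rewrite big_ord0 divr_ge0 ?powR_ge0//; lra.
have [h|h] := ltP (c * 2 ^+ k) v; last first.
  by rewrite big_mkcond big_ord_recr/= -big_mkcond/= ltNge h/= addr0.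
apply: (@le_trans _ _ (\sum_(i < k.+1) (c * 2 ^+ i) `^ s)).
  rewrite big_mkcond/=; apply: ler_sum => i _.
  by case: ifP => // _; rewrite powR_ge0.
apply: le_trans (sum_geometric_le k.+1 c0 s0) _.
have -> : (c * 2 ^+ k.+1) `^ s = (c * 2 ^+ k) `^ s * 2 `^ s.
  by rewrite exprSr mulrA powRM// ?mulr_ge0 ?exprn_ge0//; lra.
have -> : (1 - 2 `^ (- s))^-1 = 2 `^ s / (2 `^ s - 1).
  by rewrite powRN; field; apply/andP; split; lra.
rewrite [leRHS]mulrA ler_wpM2r ?invr_ge0//; first lra.
rewrite ler_wpM2r ?powR_ge0// ge0_ler_powR ?nnegrE//; [lra| |lra].
by rewrite mulr_ge0 ?exprn_ge0//; lra.
Qed.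
End real_estimates.

(** * Monotonicity of integrals and continuity of measures *)

Section integral_monotone.
Context dsp (T : measurableType dsp) (R : realType).
Variable mu : {measure set T -> \bar R}.
Local Open Scope ereal_scope.
Import HBNNSimple.

(** The integral of a nonnegative function is a supremum over the simple functions below it, hence
    monotone without measurability. Potentials, as functions of their centre, are compared in this
    way. *)
Lemma ge0_le_integral_nonmeasurable (f g : T -> \bar R) :
  (forall x, 0 <= f x) -> (forall x, f x <= g x) ->
  \int[mu]_x f x <= \int[mu]_x g x.
Proof.
move=> f0 fg; have g0 x : 0 <= g x by exact: le_trans (fg x).
rewrite !ge0_integralTE//; apply: ge_ereal_sup => _ [h hf <-].
by apply: ereal_sup_ubound; exists h => // x; exact: le_trans (fg x).
Qed.

(** Continuity from below along the partial unions; it carries the covering estimate from finite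
    families of balls to the countable union [heavy]. *)
Lemma measure_bigcup_le (F : (set T)^nat) (c : \bar R) :
  (forall k, measurable (F k)) ->
  (forall k, mu (\big[setU/set0]_(i < k) F i) <= c) -> mu (\bigcup_k F k) <= c.
Proof.
move=> mF h; pose G k := \big[setU/set0]_(i < k) F i.
have -> : \bigcup_k F k = \bigcup_k G k.
  apply/seteqP; split=> [x [k _ Fx]|x [k _]]; rewrite /G.
    by exists k.+1 => //; rewrite /G big_ord_recr/=; right.
  by rewrite -bigcup_mkord => -[i _ Fx]; exists i.
have mG k : measurable (G k) by exact: bigsetU_measurable.
have H : mu (G k) @[k --> \oo] --> mu (\bigcup_k G k).
  apply: nondecreasing_cvg_mu => //; first exact: bigcup_measurable.
  by move=> m n mn; apply/subsetPset; exact: subset_bigsetU.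
rewrite -(cvg_lim _ H)//; apply: lime_le; last exact: nearW.
by apply/cvg_ex; exists (mu (\bigcup_k G k)).
Qed.
End integral_monotone.

(** * Vitali covering and a dyadic grid of levels *)

Definition metric_ball (T : Type) (R : numDomainType) (rho : T -> T -> R) x r :=
  [set y | rho x y < r].

Section vitali.
Context dsp (T : measurableType dsp) (R : realType).
Variables (mu : {measure set T -> \bar R}) (n : nat) (w : R) (rho : T -> T -> R).
Local Notation B := (metric_ball rho).
Hypothesis rho_refl : forall x, rho x x = 0.
Hypothesis rho_sym : forall x y, rho x y = rho y x.
Hypothesis rho_triangle : forall x y z, rho x z <= rho x y + rho y z.
Hypothesis measurable_ball : forall x r, measurable (B x r).
Hypothesis mu_ball : forall x r, 0 < r -> mu (B x r) = (w * r ^+ n)%:E.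
Local Open Scope ereal_scope.

Lemma bigsetU_ball_measurable (s : seq (T * R)) :
  measurable (\big[setU/set0]_(c <- s) B c.1 c.2).
Proof. exact: bigsetU_measurable. Qed.

(* Greedy Vitali selection: enlarging the biggest ball of the family three times
   swallows every ball that meets it. *)
Lemma vitali_weak (g : T -> \bar R) (t : R) (s : seq (T * R)) :
  measurable_fun [set: T] g -> (forall x, 0 <= g x) -> (0 < t)%R ->
  (forall c, c \in s -> (0 < c.2)%R /\
     (t * (w * c.2 ^+ n))%:E <= \int[mu]_(x in B c.1 c.2) g x) ->
  t%:E * mu (\big[setU/set0]_(c <- s) B c.1 c.2) <=
  (3 ^+ n)%:E * \int[mu]_(x in \big[setU/set0]_(c <- s) B c.1 c.2) g x.
Proof.
move=> mg g0 t0; have [k] := ubnP (size s); elim: k s => // k IH [|c0 s0] sk hs.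
  by rewrite !big_nil measure0 mule0 integral_set0 mule0.
set s := c0 :: s0.
have [c cs cmax] : exists2 c, c \in s & forall c', c' \in s -> (c'.2 <= c.2)%R.
  have [i _ hi] := @arg_maxP _ R 'I_(size s) ord0 xpredT
     (fun i => (tnth (in_tuple s) i).2) isT.
  exists (tnth (in_tuple s) i); first exact: mem_tnth.
  by move=> c' /(tnthP (in_tuple s))[j ->]; exact: hi.
have [c20 hc] := hs _ cs.
(* A far ball is disjoint from the chosen one. A ball that is not far lies in [B c.1 (3 * c.2)]: its
   centre is within [c.2 + c'.2] of [c.1], and [c'.2 <= c.2] by maximality. *)
pose far := fun c' : T * R => (c.2 + c'.2 <= rho c.1 c'.1)%R.
pose s' := [seq c' <- s | far c'].
have s's c' : c' \in s' -> c' \in s by rewrite mem_filter => /andP[].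
(* The chosen [c] is not far from itself, so filtering removes it and the induction on the size
   applies. *)
have ss' : (size s' < k)%N.
  apply: (@leq_trans (size s)) => //; rewrite size_filter -(count_predC far) -addn1 leq_add2l.
  rewrite -has_count; apply/hasP; exists c => //=.
  by rewrite /far rho_refl -ltNge addr_gt0.
have sub : \big[setU/set0]_(c <- s) B c.1 c.2 `<=`
   B c.1 (3 * c.2)%R `|` \big[setU/set0]_(c <- s') B c.1 c.2.
  move=> x; rewrite -!bigcup_seq => -[c' /= c's xc'].
  have [fc'|] := boolP (far c').
    by right; exists c' => //=; rewrite mem_filter fc'.
  rewrite /far -ltNge => fc'; left.
  rewrite /metric_ball/= in xc' *.
  have := rho_triangle c.1 c'.1 x; have := cmax _ c's.
  by lra.
have subU : B c.1 c.2 `|` \big[setU/set0]_(c <- s') B c.1 c.2 `<=`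
    \big[setU/set0]_(c <- s) B c.1 c.2.
  rewrite -!bigcup_seq => x [xc|[c' /= c's xc']]; first by exists c.
  by exists c' => //=; exact: s's.
have disj : [disjoint B c.1 c.2 & \big[setU/set0]_(c <- s') B c.1 c.2].
  apply/disj_setPS => x [xc]; rewrite -bigcup_seq => -[c' /=].
  rewrite mem_filter => /andP[fc' _]; rewrite /metric_ball/= in xc * => xc'.
  have := rho_triangle c.1 x c'.1; rewrite (rho_sym x) => h.
  by move: fc' xc xc' h; rewrite /far; lra.
have mgS A : measurable_fun A g by exact: measurable_funTS.
apply: (@le_trans _ _
  (t%:E * (mu (B c.1 (3 * c.2)%R) + mu (\big[setU/set0]_(c <- s') B c.1 c.2)))).
  rewrite lee_wpmul2l ?lee_fin ?(ltW t0)//.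
  apply: (@le_trans _ _ (mu (B c.1 (3 * c.2)%R `|`
      \big[setU/set0]_(c <- s') B c.1 c.2))); last first.
    by apply: measureU2 => //; exact: bigsetU_ball_measurable.
  apply: le_measure sub; rewrite inE; first exact: bigsetU_ball_measurable.
  by apply: measurableU => //; exact: bigsetU_ball_measurable.
rewrite ge0_muleDr//; apply: (@le_trans _ _ ((3 ^+ n)%:E *
    (\int[mu]_(x in B c.1 c.2) g x +
     \int[mu]_(x in \big[setU/set0]_(c <- s') B c.1 c.2) g x))); last first.
  rewrite lee_wpmul2l ?lee_fin ?exprn_ge0//.
  rewrite -ge0_integral_setU//; last exact: bigsetU_ball_measurable.
  apply: ge0_subset_integral subU => //; last exact: bigsetU_ball_measurable.
  by apply: measurableU => //; exact: bigsetU_ball_measurable.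
rewrite ge0_muleDr ?integral_ge0//; apply: leeD; last first.
  by apply: IH => // c' /s's; exact: hs.
rewrite mu_ball ?mulr_gt0// exprMn -EFinM.
have -> : (t * (w * (3 ^+ n * c.2 ^+ n)) = 3 ^+ n * (t * (w * c.2 ^+ n)))%R by ring.
by rewrite EFinM lee_wpmul2l ?lee_fin ?exprn_ge0.
Qed.
End vitali.

(** Any positive threshold is caught, within a factor 2, by one of the [N.*2] levels 2^(i - N)
    summed in [dyadic_sum], once N is large. *)
Lemma exists_dyadic_between (R : realType) (b : R) : 0 < b ->
  exists N i, (i < N.*2)%N /\ b <= (2 ^+ N)^-1 * 2 ^+ i <= 2 * b.
Proof.
move=> b0; pose m := (Num.truncn (Num.max b b^-1)).+1.
have hm : Num.max b b^-1 < 2 ^+ m.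
  apply: lt_trans (truncnS_gt _) _.
  by rewrite -natrX ltr_nat ltn_expl.
move: hm; rewrite gt_max => /andP[bm bVm].
have e2 k : 0 < 2 ^+ k :> R by rewrite exprn_gt0.
have ex : exists i, b <= (2 ^+ m.+1)^-1 * 2 ^+ i.
  exists (m.+1.*2.-1); rewrite -addnn addSn/= exprD mulrCA mulVf ?gt_eqF// mulr1 ltW//.
(* With i least, the preceding level is below [b], which gives the upper bound by doubling; for i =
   0 the level 2^(-m-1) is already below [b], because 1/b < 2^m. *)
exists m.+1; case: (ex_minnP ex) => i bi mini; exists i; split.
  have := mini (m.+1.*2.-1); rewrite doubleS/= ltnS; apply.
  by rewrite -addnn -addSn exprD mulrA mulVf ?gt_eqF// mul1r ltW.
rewrite bi/=; case: i bi mini => [|i] bi mini.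
  rewrite mulr1 (@le_trans _ _ b)//; last lra.
  rewrite -(invrK b) lef_pV2 ?posrE ?invr_gt0//.
  by rewrite ltW// (lt_le_trans bVm)// exprS; have := e2 m; lra.
have : (2 ^+ m.+1)^-1 * 2 ^+ i < b.
  by rewrite ltNge; apply/negP => /mini; rewrite ltnn.
by rewrite [2 ^+ i.+1]exprS; lra.
Qed.

(** * Integrals of kernels over dyadic annuli *)

Section annuli.
Context dsp (T : measurableType dsp) (R : realType).
Variables (mu : {measure set T -> \bar R}) (n : nat) (w : R) (rho : T -> T -> R).
Local Notation B := (metric_ball rho).
Hypothesis w_gt0 : 0 < w.
Hypothesis rho_ge0 : forall x y, 0 <= rho x y.
Hypothesis measurable_ball : forall x r, measurable (B x r).
Hypothesis mu_ball : forall x r, 0 < r -> mu (B x r) = (w * r ^+ n)%:E.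

(** The function [h] is at most the sum over all j of [c j * g] restricted to the j-th ball, whether
    or not the balls overlap; integrating termwise leaves a geometric series of ratio [theta]. *)
Lemma integral_annuli_le x (h g : T -> R) (c r : nat -> R) a theta :
  measurable_fun [set: T] g -> (forall y, 0 <= g y) -> (forall y, 0 <= h y) ->
  (forall j, 0 <= c j) -> 0 <= a -> 0 <= theta < 1 ->
  (forall y, h y != 0 -> exists j, rho x y < r j /\ h y <= c j * g y) ->
  (forall j, ((c j)%:E * \int[mu]_(y in B x (r j)) (g y)%:E <= (a * theta ^+ j)%:E)%E) ->
  (\int[mu]_y (h y)%:E <= (a / (1 - theta))%:E)%E.
Proof.
move=> mg g0 h0 c0 a0 /andP[th0 th1] hc hI.
pose F j y := ((c j)%:E * ((EFin \o g) \_ (B x (r j))) y)%E.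
have mF j : measurable_fun [set: T] ((EFin \o g) \_ (B x (r j))).
  apply/(measurable_restrictT _ (measurable_ball _ _))/measurable_funTS.
  exact/measurable_EFinP.
have g'0 j y : (0 <= ((EFin \o g) \_ (B x (r j))) y)%E.
  by rewrite patchE; case: ifP => //= _; rewrite lee_fin.
have F0 j y : (0 <= F j y)%E by rewrite mule_ge0// lee_fin.
apply: (@le_trans _ _ (\int[mu]_y \sum_(j <oo) F j y)%E).
  apply: ge0_le_integral_nonmeasurable => y; first by rewrite lee_fin.
  have [->|/hc [j [rj hj]]] := eqVneq (h y) 0; first exact: nneseries_ge0.
  apply: (@le_trans _ _ (F j y)).
    by rewrite /F patchE mem_set//= -EFinM lee_fin.
  apply: le_trans (nneseries_lim_ge j.+1 _) => //.
  by rewrite big_nat_recr//= leeDr// sume_ge0.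
rewrite integral_nneseries//; last by move=> j; exact: measurable_funeM.
have FE j : (\int[mu]_y F j y = (c j)%:E * \int[mu]_(y in B x (r j)) (g y)%:E)%E.
  by rewrite ge0_integralZl ?lee_fin// -integral_mkcond.
under eq_eseriesr do rewrite FE.
apply: lime_le.
  by apply: is_cvg_nneseries => j _ _; rewrite -FE; apply: integral_ge0 => y _.
apply: nearW => k; apply: (@le_trans _ _ (\sum_(0 <= j < k) (a * theta ^+ j)%:E)%E).
  exact: lee_sum.
rewrite sumEFin lee_fin -big_distrr/= ler_wpM2l// big_mkord.
rewrite -[leRHS]mul1r ler_pdivlMr; last by lra.
rewrite -opprB mulrN mulrC -subrX1 opprB lerBlDr lerDl exprn_ge0//.
Qed.

Lemma powR_half_expn s j : (2^-1 ^+ j) `^ s = (2 `^ (- s)) ^+ j :> R.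
Proof.
have h0 : 0 <= 2^-1 :> R by rewrite invr_ge0.
rewrite -(powR_mulrn j h0) -(powR_mulrn j (powR_ge0 2 (- s))) powRAC.
have -> : 2^-1 = 2 `^ (-1) :> R by rewrite powR_inv1.
by rewrite -[in LHS](powRrM 2) mulN1r.
Qed.

Lemma powR_2_expn s j : (2 ^+ j) `^ s = (2 `^ s) ^+ j :> R.
Proof.
rewrite -(powR_mulrn j (ler0n R 2)) -(powR_mulrn j (powR_ge0 2 s)).
by rewrite powRAC. Qed.

Lemma exists_dyadic_below (d r : R) : 0 < r < d ->
  exists j, d * 2^-1 ^+ j.+1 <= r < d * 2^-1 ^+ j.
Proof.
move=> /andP[r0 rd].
have ex : exists j, d * 2^-1 ^+ j.+1 <= r.
  exists (Num.truncn (d / r)); rewrite exprVn ler_pdivrMr ?exprn_gt0//.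
  rewrite mulrC -ler_pdivrMr// (le_trans (ltW (truncnS_gt _)))//.
  by rewrite -natrX ler_nat ltnW// ltn_expl.
case: (ex_minnP ex) => j hj minj; exists j; rewrite hj/=.
case: j hj minj => [|j] hj minj; first by rewrite mulr1.
by rewrite ltNge; apply/negP => /minj; rewrite ltnn.
Qed.

Lemma exists_dyadic_above (d r : R) : 0 < d <= r ->
  exists j, d * 2 ^+ j <= r < d * 2 ^+ j.+1.
Proof.
move=> /andP[d0 dr].
have ex : exists j, r < d * 2 ^+ j.+1.
  exists (Num.truncn (r / d)); rewrite mulrC -ltr_pdivrMr//.
  rewrite (lt_le_trans (truncnS_gt _))//.
  by rewrite -natrX ler_nat ltnW// ltn_expl.
case: (ex_minnP ex) => j hj minj; exists j; rewrite hj andbT.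
case: j hj minj => [|j] hj minj; first by rewrite mulr1.
by rewrite leNgt; apply/negP => /minj; rewrite ltnn.
Qed.

Lemma integral_near_le (g : T -> R) x M d lam :
  measurable_fun [set: T] g -> (forall y, 0 <= g y) ->
  0 < lam < n%:R -> 0 <= M -> 0 < d ->
  (forall r, 0 < r -> (\int[mu]_(y in B x r) (g y)%:E <= (M * r ^+ n)%:E)%E) ->
  (\int[mu]_y (if rho x y < d then g y / rho x y `^ lam else 0)%:E <=
   (2 `^ lam * M * d `^ (n%:R - lam) / (1 - 2 `^ (- (n%:R - lam))))%:E)%E.
Proof.
move=> mg g0 /andP[l0 ln] M0 d0 hM.
have nl0 : 0 < n%:R - lam by lra.
have dj0 j : 0 < d * 2^-1 ^+ j by rewrite mulr_gt0 ?exprn_gt0 ?invr_gt0.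
apply: (@integral_annuli_le x _ g (fun j => (d * 2^-1 ^+ j.+1) `^ (- lam))
    (fun j => d * 2^-1 ^+ j)) => //.
- by move=> y; case: ifP => // _; rewrite divr_ge0 ?powR_ge0.
- by move=> j; rewrite powR_ge0.
- by rewrite !mulr_ge0 ?powR_ge0.
- by rewrite powR_ge0 powR2N_lt1.
- move=> y; case: ifPn => [yd hy|]; last by rewrite eqxx.
  (* At distance 0 the quotient takes the default value 0, since 0 to the power [lam] is 0 and so is
     its inverse; [hy] excludes this case. *)
  have r0 : 0 < rho x y.
    rewrite lt_def rho_ge0 andbT; apply/eqP => r0.
    by move: hy; rewrite r0 powR0 ?(gt_eqF l0)//; rewrite invr0 mulr0 eqxx.
  have /exists_dyadic_below[j /andP[j1 j2]] : 0 < rho x y < d by rewrite r0.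
  exists j; split => //; rewrite mulrC ler_wpM2r// powRN.
  by rewrite lef_pV2 ?posrE ?powR_gt0// ge0_ler_powR ?nnegrE ?(ltW l0) ?(ltW r0)// ltW.
- move=> j; apply: (@le_trans _ _ (((d * 2^-1 ^+ j.+1) `^ (- lam))%:E *
     (M * (d * 2^-1 ^+ j) ^+ n)%:E)%E).
    by rewrite lee_wpmul2l ?lee_fin ?powR_ge0 ?hM.
  rewrite -EFinM lee_fin le_eqVlt; apply/orP; left; apply/eqP.
  have -> : d * 2^-1 ^+ j.+1 = (d * 2^-1 ^+ j) / 2 by rewrite exprSr mulrA.
  have d'0 := ltW (dj0 j).
  rewrite -[RHS]mulrA.
  have <- : (d * 2^-1 ^+ j) `^ (n%:R - lam) = d `^ (n%:R - lam) * (2 `^ (- (n%:R - lam))) ^+ j.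
    by rewrite powRM ?(ltW d0) ?exprn_ge0 ?invr_ge0// powR_half_expn.
  have <- : (d * 2^-1 ^+ j) `^ n%:R = (d * 2^-1 ^+ j) ^+ n by rewrite powR_mulrn.
  have -> : (d * 2^-1 ^+ j / 2) `^ (- lam) = (d * 2^-1 ^+ j) `^ (- lam) * 2 `^ lam.
    rewrite powRM ?invr_ge0//; congr (_ * _).
    have -> : 2^-1 = 2 `^ (-1) :> R by rewrite powR_inv1.
    by rewrite -(powRrM 2) mulrNN mul1r.
  have -> : (d * 2^-1 ^+ j) `^ (n%:R - lam) =
      (d * 2^-1 ^+ j) `^ n%:R * (d * 2^-1 ^+ j) `^ (- lam).
    by rewrite powRD// (gt_eqF (dj0 j)) implybT.
  by ring.
Qed.

(** Outward annuli with [g] constant equal to 1: the j-th one contributes (d 2^j)^(-m) times the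
    measure of a ball of radius d 2^(j+1), so the ratio is 2^(-(m-n)). It serves with m =
    [lam * p'], the kernel raised to the conjugate exponent. *)
Lemma integral_far_kernel_le x d m : n%:R < m -> 0 < d ->
  (\int[mu]_y (if d <= rho x y then rho x y `^ (- m) else 0)%:E <=
   (w * 2 ^+ n * d `^ (- (m - n%:R)) / (1 - 2 `^ (- (m - n%:R))))%:E)%E.
Proof.
move=> nm d0; have mn0 : 0 < m - n%:R by lra.
have dj0 j : 0 < d * 2 ^+ j by rewrite mulr_gt0 ?exprn_gt0.
apply: (@integral_annuli_le x _ (cst 1) (fun j => (d * 2 ^+ j) `^ (- m))
    (fun j => d * 2 ^+ j.+1)) => //.
- by move=> y; case: ifP => // _; rewrite powR_ge0.
- by move=> j; rewrite powR_ge0.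
- by rewrite !mulr_ge0 ?exprn_ge0 ?powR_ge0// ltW.
- by rewrite powR_ge0 powR2N_lt1.
- move=> y; case: ifPn => [yd hy|]; last by rewrite eqxx.
  have r0 : 0 < rho x y by lra.
  have /exists_dyadic_above[j /andP[j1 j2]] : 0 < d <= rho x y by rewrite d0.
  exists j; split => //; rewrite mulr1 !powRN.
  rewrite lef_pV2 ?posrE ?powR_gt0// ge0_ler_powR ?nnegrE ?(ltW r0) ?(ltW (dj0 j))//.
  by rewrite (le_trans _ (ltW nm)).
- move=> j; rewrite (integral_cst mu (measurable_ball _ _) 1%E) mul1e mu_ball//.
  rewrite -EFinM lee_fin le_eqVlt; apply/orP; left; apply/eqP.
  have d'0 := ltW (dj0 j).
  have -> : d * 2 ^+ j.+1 = 2 * (d * 2 ^+ j) by rewrite exprS mulrCA.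
  rewrite -[RHS]mulrA.
  have <- : (d * 2 ^+ j) `^ (- (m - n%:R)) = d `^ (- (m - n%:R)) * (2 `^ (- (m - n%:R))) ^+ j.
    by rewrite powRM ?(ltW d0) ?exprn_ge0// powR_2_expn.
  rewrite exprMn.
  have <- : (d * 2 ^+ j) `^ n%:R = (d * 2 ^+ j) ^+ n by rewrite powR_mulrn.
  have -> : (d * 2 ^+ j) `^ (- (m - n%:R)) =
      (d * 2 ^+ j) `^ n%:R * (d * 2 ^+ j) `^ (- m).
    by rewrite opprB powRD// (gt_eqF (dj0 j)) implybT.
  by ring.
Qed.
End annuli.

(** * Optimisation in the splitting radius *)

Section optimisation.
Context (R : realType).

Lemma optimise_two_powers (X : \bar R) (A C u v al be : R) :
  (0 <= X)%E -> 0 <= A -> 0 <= C -> 0 <= u -> 0 <= v -> 0 < al -> 0 < be ->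
  (forall d, 0 < d -> (X <= (A * u * d `^ al + C * v * d `^ (- be))%:E)%E) ->
  (X <= ((A + C) * u `^ (be / (al + be)) * v `^ (al / (al + be)))%:E)%E.
Proof.
move=> X0 A0 C0 u0 v0 al0 be0 hX.
case: X X0 hX => [X| |//] X0 hX; last by have := hX 1 ltr01.
rewrite !lee_fin in X0 *.
have {}hX d : 0 < d -> X <= A * u * d `^ al + C * v * d `^ (- be).
  by move=> /hX; rewrite lee_fin.
have ab : 0 < al + be by lra.
have inv_powR (z c : R) : 0 < z -> 0 < c -> (z `^ c^-1) `^ c = z.
  by move=> z0 c0; rewrite -powRrM mulVf ?gt_eqF// powRr1// ltW.
(* A vanishing factor makes the claimed bound 0, and no radius balances the two terms. For u = 0 a
   radius with d^be = (C v + 1)/X contradicts X > 0; for v = 0 one with d^al = X/(A u + 1) does. *)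
have [u00|un0] := eqVneq u 0.
  rewrite u00 powR0 ?gt_eqF ?divr_gt0// mulr0 mul0r leNgt; apply/negP => Xp.
  have k0 : 0 <= C * v by rewrite mulr_ge0.
  have z0 : 0 < (C * v + 1) / X by rewrite divr_gt0//; lra.
  have := hX _ (powR_gt0 be^-1 z0); rewrite u00 mulr0 mul0r add0r powRN inv_powR//.
  rewrite invf_div mulrA ler_pdivlMr; last lra.
  by rewrite mulrDr mulr1 mulrC gerDl; lra.
have [v00|vn0] := eqVneq v 0.
  rewrite v00 [X in _ * X]powR0 ?gt_eqF ?divr_gt0// mulr0 leNgt; apply/negP => Xp.
  have k0 : 0 <= A * u by rewrite mulr_ge0.
  have z0 : 0 < X / (A * u + 1) by rewrite divr_gt0//; lra.
  have := hX _ (powR_gt0 al^-1 z0); rewrite v00 mulr0 mul0r addr0 inv_powR//.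
  rewrite mulrA ler_pdivlMr; last lra.
  by rewrite mulrDr mulr1 mulrC gerDl; lra.
have up : 0 < u by rewrite lt_def un0.
have vp : 0 < v by rewrite lt_def vn0.
have vu : 0 < v / u by rewrite divr_gt0.
(* At this radius u d^al and v d^(-be) are equal, with common value u^(be/(al+be))
   v^(al/(al+be)). *)
apply: le_trans (hX _ (powR_gt0 (al + be)^-1 vu)) _.
rewrite -!powRrM.
have vuE s : (v / u) `^ s = v `^ s * u `^ (- s).
  rewrite powRM ?invr_ge0//; congr (_ * _).
  by rewrite -(@powR_inv1 _ u)// -powRrM mulN1r.
rewrite !vuE le_eqVlt; apply/orP; left; apply/eqP.
have -> : (al + be)^-1 * al = al / (al + be) by rewrite mulrC.
have -> : (al + be)^-1 * - be = - (be / (al + be)) by rewrite mulrN mulrC.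
have E : be / (al + be) = 1 - al / (al + be) by field; rewrite gt_eqF.
rewrite opprK E.
have D w z : 0 < w -> w `^ (1 - z) = w * w `^ (- z).
  by move=> w0; rewrite powRD ?powRr1 ?(ltW w0)// (gt_eqF w0) implybT.
rewrite D// opprB.
have -> : v `^ (al / (al + be) - 1) = v `^ (al / (al + be)) / v.
  rewrite powRD; first by rewrite powR_inv1 ?ltW.
  by rewrite (gt_eqF vp) implybT.
by field; rewrite gt_eqF.
Qed.
End optimisation.

(** * Weak-type estimate for the level sets of the maximal function *)

Section hedberg.
Context dsp (T : measurableType dsp) (R : realType).
Variables (mu : {measure set T -> \bar R}) (n : nat) (w : R) (rho : T -> T -> R).
Local Notation B := (metric_ball rho).
Hypothesis w_gt0 : 0 < w.
Hypothesis rho_refl : forall x, rho x x = 0.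
Hypothesis rho_ge0 : forall x y, 0 <= rho x y.
Hypothesis rho_sym : forall x y, rho x y = rho y x.
Hypothesis rho_triangle : forall x y z, rho x z <= rho x y + rho y z.
Hypothesis measurable_rho : forall x, measurable_fun [set: T] (rho x).
Hypothesis measurable_ball : forall x r, measurable (B x r).
Hypothesis mu_ball : forall x r, 0 < r -> mu (B x r) = (w * r ^+ n)%:E.
Variable D : nat -> T.
Hypothesis dense_D : forall x r, 0 < r -> exists k, rho (D k) x < r.
Variable g : T -> R.
Hypothesis measurable_g : measurable_fun [set: T] g.
Hypothesis g_ge0 : forall x, 0 <= g x.

(* The ball encoded by k when the mean of g on it exceeds t, else set0. *)
Definition heavy_ball (t : R) (k : nat) : set T :=
  if @unpickle (nat * rat)%type k is Some c then
    if `[< 0 < ratr c.2 :> R /\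
           ((t * (w * ratr c.2 ^+ n))%:E < \int[mu]_(x in B (D c.1) (ratr c.2)) (g x)%:E)%E >]
    then B (D c.1) (ratr c.2) else set0
  else set0.

(** The set where the uncentred maximal function over balls with centre in [D] and rational radius
    exceeds [t]; countability of the family makes it measurable. *)
Definition heavy t := \bigcup_k heavy_ball t k.

Lemma measurable_heavy_ball t k : measurable (heavy_ball t k).
Proof. by rewrite /heavy_ball; case: unpickle => // c; case: ifP. Qed.

Lemma measurable_heavy t : measurable (heavy t).
Proof. by apply: bigcup_measurable => k _; exact: measurable_heavy_ball. Qed.

Lemma heavy_bigsetU t k : exists s : seq (T * R),
  (forall c, c \in s -> 0 < c.2 /\
     ((t * (w * c.2 ^+ n))%:E < \int[mu]_(x in B c.1 c.2) (g x)%:E)%E) /\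
  \big[setU/set0]_(i < k) heavy_ball t i = \big[setU/set0]_(c <- s) B c.1 c.2.
Proof.
elim: k => [|k [s [hs Es]]].
  by exists [::]; rewrite big_ord0 big_nil.
rewrite big_ord_recr/= Es /heavy_ball.
case: unpickle => [c|]; last by exists s; rewrite setU0.
case: asboolP => hc; last by exists s; rewrite setU0.
exists ((D c.1, ratr c.2) :: s); split; last by rewrite big_cons setUC.
by move=> c'; rewrite inE => /orP[/eqP ->//|]; exact: hs.
Qed.

(** The part of [g] with [2 * g <= t] contributes at most half of the mass [t] times the measure of
    a heavy ball, so the truncation to [t < 2 * g] has mean at least [t / 2] there, and the covering
    lemma applies to it. Keeping the truncation on the right is what makes the sum over levels
    converge. *)
Lemma measure_heavy_le t : 0 < t ->
  (t%:E * mu (heavy t) <=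
   (2 * 3 ^+ n)%:E * \int[mu]_(x in [set x | (t < 2 * g x)%R]) (g x)%:E)%E.
Proof.
move=> t0; pose A := [set x | t < 2 * g x].
have mg : measurable_fun [set: T] (fun x => 2 * g x) by exact: measurable_funM.
have mA : measurable A.
  by rewrite -[A]setTI; exact: measurable_fun_ltr.
have t20 : 0 < t / 2 by lra.
rewrite -lee_pdivlMl//; apply: measure_bigcup_le => [k|k].
  exact: measurable_heavy_ball.
rewrite lee_pdivlMl//.
have [s [hs ->]] := heavy_bigsetU t k.
pose g' := (EFin \o g) \_ A.
have mg' : measurable_fun [set: T] g'.
  apply/(measurable_restrictT _ mA)/measurable_funTS.
  exact/measurable_EFinP.
have g'0 x : (0 <= g' x)%E by rewrite /g' patchE; case: ifP => //= _; rewrite lee_fin.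
have hv c : c \in s -> 0 < c.2 /\
    ((t / 2 * (w * c.2 ^+ n))%:E <= \int[mu]_(x in B c.1 c.2) g' x)%E.
  move=> cs; have [c0 hc] := hs c cs; split => //.
  have : ((t * (w * c.2 ^+ n))%:E <= (t / 2 * (w * c.2 ^+ n))%:E + \int[mu]_(x in B c.1 c.2) g' x)%E.
    apply: le_trans (ltW hc) _.
    rewrite EFinM -(mu_ball c.1 c0) -integral_cst// -ge0_integralD//; last first.
    - exact: measurable_funTS.
    - by move=> x _; rewrite lee_fin ltW.
    apply: ge0_le_integral => //.
    - by move=> x _; rewrite lee_fin.
    - by apply/measurable_EFinP; exact: measurable_funTS.
    - by apply: emeasurable_funD => //; exact: measurable_funTS.
    - move=> x _; rewrite /g' patchE; case: ifPn => [_|].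
        by rewrite leeDr// lee_fin ltW.
      by rewrite notin_setE /A/= adde0 lee_fin; lra.
  have -> : t * (w * c.2 ^+ n) = t / 2 * (w * c.2 ^+ n) + t / 2 * (w * c.2 ^+ n) by field.
  by rewrite EFinD leeD2lE.
have hb := vitali_weak rho_refl rho_sym rho_triangle measurable_ball mu_ball
  mg' g'0 t20 hv.
have -> : t%:E = (2%:E * (t / 2)%:E)%E by rewrite -EFinM; congr EFin; field.
rewrite (EFinM 2) -!muleA lee_wpmul2l//.
apply: le_trans hb _; rewrite lee_wpmul2l ?lee_fin ?exprn_ge0//.
rewrite (integral_mkcond [set x | (t < 2 * g x)%R]).
by apply: ge0_subset_integral => //; exact: bigsetU_ball_measurable.
Qed.

(** * Strong (p, p) bound by summation over dyadic levels *)

Definition level N i : R := (2 ^+ N)^-1 * 2 ^+ i.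

Lemma level_gt0 N i : 0 < level N i.
Proof. by rewrite mulr_gt0 ?invr_gt0 ?exprn_gt0. Qed.

Lemma levelSS N i : level N.+1 i.+1 = level N i.
Proof.
by rewrite /level !exprS invfM mulrACA mulVf ?mul1r// pnatr_eq0.
Qed.

(* Up to constants, the p-th power of the maximal function, discretised at the
   levels 2^(i - N). *)
Definition dyadic_sum p N x : R :=
  \sum_(i < N.*2) level N i `^ p * \1_(heavy (level N i)) x.

Lemma dyadic_sum_ge0 p N x : 0 <= dyadic_sum p N x.
Proof. by apply: sumr_ge0 => i _; rewrite mulr_ge0 ?powR_ge0. Qed.

(** By [levelSS], passing from N to N+1 keeps all levels, shifted by one index, and adds one below
    and one above. *)
Lemma nondecreasing_dyadic_sum p x : nondecreasing_seq (dyadic_sum p ^~ x).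
Proof.
apply/nondecreasing_seqP => N; rewrite /dyadic_sum doubleS.
rewrite big_ord_recl big_ord_recr/=.
under [in leRHS]eq_bigr do rewrite /bump/= add1n levelSS.
rewrite addrCA lerDl addr_ge0// mulr_ge0 ?powR_ge0//.
Qed.

Lemma le_dyadic_sum p N i x : (i < N.*2)%N -> heavy (level N i) x ->
  level N i `^ p <= dyadic_sum p N x.
Proof.
move=> iN hx; rewrite /dyadic_sum (bigD1 (Ordinal iN))//= indicE mem_set//.
by rewrite mulr1 lerDl; apply: sumr_ge0 => j _; rewrite mulr_ge0 ?powR_ge0.
Qed.

Lemma measurable_dyadic_sum p N : measurable_fun [set: T] (dyadic_sum p N).
Proof.
apply: measurable_sum => i; apply: measurable_funM => //.
exact/measurable_indic/measurable_heavy.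
Qed.

(** A discrete layer-cake argument: the weak bound replaces t^p times the measure of [heavy t] by
    t^(p-1) times the integral of [g] over t < 2g. Exchanging sum and integral leaves at each point
    the sum of t^(p-1) over the levels t < 2g, a geometric sum bounded independently of N. *)
Lemma integral_dyadic_sum_le p N : 1 < p ->
  (\int[mu]_x (dyadic_sum p N x)%:E <=
   (3 ^+ n * (2 `^ p / (1 - 2 `^ (- (p - 1)))))%:E * \int[mu]_x (g x `^ p)%:E)%E.
Proof.
move=> p1; have p10 : 0 < p - 1 by lra.
have b2 := powR2N_lt1 p10.
pose A i := [set x | level N i < 2 * g x].
have mA i : measurable (A i).
  rewrite -[A i]setTI; apply: measurable_fun_ltr => //.
  exact: measurable_funM.
have mgp : measurable_fun [set: T] (fun x => g x `^ p).
  exact: (measurableT_comp (measurable_powR p)).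
have -> : (\int[mu]_x (dyadic_sum p N x)%:E =
    \sum_(i < N.*2) (level N i `^ p)%:E * mu (heavy (level N i)))%E.
  under eq_integral do rewrite /dyadic_sum -sumEFin.
  rewrite ge0_integral_sum//.
  - apply: eq_bigr => i _; under eq_integral do rewrite EFinM.
    rewrite ge0_integralZl//; last by rewrite lee_fin powR_ge0.
      by rewrite integral_indic ?setIT//; exact: measurable_heavy.
    exact/measurable_EFinP/measurable_indic/measurable_heavy.
  - move=> i; apply/measurable_EFinP; apply: measurable_funM => //.
    exact/measurable_indic/measurable_heavy.
  - by move=> i x _; rewrite lee_fin mulr_ge0 ?powR_ge0.
pose h (i : 'I_(N.*2)) x := level N i `^ (p - 1) * (g x * \1_(A i) x).
have mh i : measurable_fun [set: T] (h i).
  by apply: measurable_funM => //; exact: measurable_funM.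
have h0 i x : 0 <= h i x by rewrite !mulr_ge0 ?powR_ge0.
apply: (@le_trans _ _ (\sum_(i < N.*2) (2 * 3 ^+ n)%:E * \int[mu]_x (h i x)%:E)%E).
  apply: lee_sum => i _.
  rewrite -(mulr_powRB1 (ltW (level_gt0 N i))); last lra.
  rewrite (EFinM (level N i)) muleAC.
  apply: (@le_trans _ _ ((2 * 3 ^+ n)%:E * \int[mu]_(x in A i) (g x)%:E *
    (level N i `^ (p - 1))%:E))%E.
    rewrite lee_wpmul2r ?lee_fin ?powR_ge0//; apply: measure_heavy_le => //.
    exact: level_gt0.
  rewrite -muleA lee_wpmul2l//.
  rewrite muleC integral_mkcond -ge0_integralZl//; first last.
  - by rewrite lee_fin powR_ge0.
  - by move=> x _; rewrite patchE; case: ifP => //; rewrite lee_fin.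
  - apply/(measurable_restrictT _ (mA i))/measurable_funTS.
    exact/measurable_EFinP.
  rewrite le_eqVlt; apply/orP; left; apply/eqP/eq_integral => x _; rewrite patchE /h indicE.
  by case: (x \in A i); rewrite ?mulr1// mulr0 mulr0; apply: mule0.
rewrite -ge0_sume_distrr; last first.
  by move=> i _; apply: integral_ge0 => x _; rewrite lee_fin.
rewrite -ge0_integral_sum//; last first.
- by move=> i x _; rewrite lee_fin.
- by move=> i; exact/measurable_EFinP.
have -> : 3 ^+ n * (2 `^ p / (1 - 2 `^ (- (p - 1)))) =
   (2 * 3 ^+ n) * (2 `^ (p - 1) / (1 - 2 `^ (- (p - 1)))).
  rewrite -(@mulr_powRB1 _ 2 p)//; last lra.
  by field; apply/eqP; lra.
rewrite (EFinM (2 * 3 ^+ n)) -muleA lee_wpmul2l//.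
rewrite -ge0_integralZl//; first last.
- by rewrite lee_fin divr_ge0 ?powR_ge0//; lra.
- by move=> x _; rewrite lee_fin powR_ge0.
- exact/measurable_EFinP.
apply: ge0_le_integral_nonmeasurable => x.
  by rewrite sumEFin lee_fin sumr_ge0.
rewrite sumEFin lee_fin /h.
have -> : \sum_(i < N.*2) level N i `^ (p - 1) * (g x * \1_(A i) x) =
   g x * \sum_(i < N.*2 | (2 ^+ N)^-1 * 2 ^+ i < 2 * g x) level N i `^ (p - 1).
  rewrite big_distrr/= [RHS]big_mkcond/=; apply: eq_bigr => i _.
  rewrite indicE; case: ifPn => hi.
    by rewrite mem_set// mulr1 mulrC.
  by rewrite memNset ?mulr0//; exact/negP.
apply: (@le_trans _ _ (g x * ((2 * g x) `^ (p - 1) / (1 - 2 `^ (- (p - 1)))))).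
  rewrite ler_wpM2l//; apply: sum_geometric_below_le => //.
  by rewrite mulr_ge0.
rewrite powRM// -(@mulr_powRB1 _ (g x) p)//; last lra.
by rewrite le_eqVlt; apply/orP; left; apply/eqP; ring.
Qed.

Definition dyadic_max p x : \bar R := limn (fun N => (dyadic_sum p N x)%:E).

Lemma dyadic_max_ub p N x : ((dyadic_sum p N x)%:E <= dyadic_max p x)%E.
Proof.
rewrite /dyadic_max (cvg_lim _ (ereal_nondecreasing_cvgn _))//.
  by apply: ereal_sup_ubound; exists N.
by move=> a b ab; rewrite lee_fin nondecreasing_dyadic_sum.
Qed.

Lemma dyadic_max_ge0 p x : (0 <= dyadic_max p x)%E.
Proof. by apply: le_trans (dyadic_max_ub p 0 x); rewrite lee_fin dyadic_sum_ge0. Qed.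

Lemma measurable_dyadic_max p : measurable_fun [set: T] (dyadic_max p).
Proof.
apply: (emeasurable_fun_cvg (fun N x => (dyadic_sum p N x)%:E)) => [N|x _].
  exact/measurable_EFinP/measurable_dyadic_sum.
apply: ereal_nondecreasing_is_cvgn => a b ab.
by rewrite lee_fin nondecreasing_dyadic_sum.
Qed.

Lemma integral_dyadic_max_le p : 1 < p ->
  (\int[mu]_x dyadic_max p x <=
   (3 ^+ n * (2 `^ p / (1 - 2 `^ (- (p - 1)))))%:E * \int[mu]_x (g x `^ p)%:E)%E.
Proof.
move=> p1; rewrite /dyadic_max monotone_convergence//.
- apply: lime_le; last by apply: nearW => N; exact: integral_dyadic_sum_le.
  apply: ereal_nondecreasing_is_cvgn => a b ab.
  apply: ge0_le_integral_nonmeasurable => x; rewrite lee_fin.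
    exact: dyadic_sum_ge0.
  exact: nondecreasing_dyadic_sum.
- by move=> N; exact/measurable_EFinP/measurable_dyadic_sum.
- by move=> N x _; rewrite lee_fin dyadic_sum_ge0.
- by move=> x _ a b ab; rewrite lee_fin nondecreasing_dyadic_sum.
Qed.

(* dyadic_max p ^ (1/p) dominates the uncentred maximal function up to a constant. *)
Lemma integral_ball_le p x s r : 0 < p -> dyadic_max p x = s%:E -> 0 < r ->
  (\int[mu]_(y in B x r) (g y)%:E <= (2 * s `^ p^-1 * (w * (3 * r) ^+ n))%:E)%E.
Proof.
move=> p0 Sx r0.
have s0 : 0 <= s by rewrite -lee_fin -Sx dyadic_max_ge0.
have mg : measurable_fun [set: T] (EFin \o g) by exact/measurable_EFinP.
have [k hk] := dense_D x r0.
(* A radius above 2r makes the ball about [D k] contain [B x r], as [D k] is within r of x; staying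
   below 3r costs the factor 3^n. *)
have [q /andP[q2 q3]] : exists q : rat, 2 * r < ratr q < 3 * r.
  have /rat_in_itvoo[q] : 2 * r < 3 * r by lra.
  by rewrite in_itv/=; exists q.
have q0 : 0 < ratr q :> R by lra.
have w0 : 0 < w * ratr q ^+ n by rewrite mulr_gt0 ?exprn_gt0.
apply: (@le_trans _ _ (\int[mu]_(y in B (D k) (ratr q)) (g y)%:E)%E).
  apply: ge0_subset_integral => //.
  - exact: measurable_funTS.
  - by move=> y _; rewrite lee_fin.
  - move=> y; rewrite /metric_ball/= => xy.
    by have := rho_triangle (D k) x y; lra.
apply: (@le_trans _ _ (2 * s `^ p^-1 * (w * ratr q ^+ n))%:E); last first.
  rewrite lee_fin !ler_wpM2l ?powR_ge0 ?mulr_ge0 ?powR_ge0// ?(ltW w_gt0)//.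
  by rewrite lerXn2r ?nnegrE//; lra.
apply/lee_addgt0Pr => e e0; rewrite -EFinD.
(* The slack [e] makes [b] positive and strictly larger than s^(1/p). If the mean exceeded 2b, a
   level between b and 2b would have x in its heavy set, and its p-th power would be at most s, a
   contradiction. *)
pose b := s `^ p^-1 + e / (2 * (w * ratr q ^+ n)).
have sb : s `^ p^-1 < b by rewrite /b ltrDl divr_gt0// mulr_gt0.
have b0 : 0 < b by rewrite (le_lt_trans _ sb)// powR_ge0.
have -> : 2 * s `^ p^-1 * (w * ratr q ^+ n) + e = 2 * b * (w * ratr q ^+ n).
  by rewrite /b; field; rewrite !gt_eqF ?exprn_gt0.
rewrite leNgt; apply/negP => hb.
have [N [i [iN /andP[h1 h2]]]] := exists_dyadic_between b0.
have hx : heavy (level N i) x.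
  exists (pickle (k, q)) => //; rewrite /heavy_ball pickleK/=.
  rewrite asboolT.
    by rewrite /metric_ball/=; lra.
  split => //; apply: le_lt_trans hb; rewrite lee_fin.
  by rewrite ler_wpM2r// ltW.
have := dyadic_max_ub p N x; rewrite Sx lee_fin => /(le_trans (le_dyadic_sum p iN hx)).
have l0 := level_gt0 N i.
move=> hs; have : level N i <= s `^ p^-1.
  rewrite -[leLHS]powRr1 ?(ltW l0)// -(@mulfV _ p) ?gt_eqF// powRrM.
  by rewrite ge0_ler_powR ?nnegrE ?powR_ge0// invr_ge0 ltW.
by apply/negP; rewrite -ltNge; exact: lt_le_trans h1.
Qed.

(** * Hedberg's pointwise inequality and the resulting L^q bound *)

Lemma integral_far_le x d lam p p' c :
  0 < p -> 0 < p' -> p^-1 + p'^-1 = 1 -> n%:R < lam * p' -> 0 < d -> 0 <= c ->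
  ('N[mu]_p%:E[EFin \o g] <= c%:E)%E ->
  (\int[mu]_y (if (d <= rho x y)%R then g y / rho x y `^ lam else 0)%:E <=
   (c * (w * 2 ^+ n * d `^ (- (lam * p' - n%:R)) /
         (1 - 2 `^ (- (lam * p' - n%:R)))) `^ p'^-1)%:E)%E.
Proof.
move=> p0 p'0 pp' nm d0 c0 hc.
pose K y := rho x y `^ (- lam) * \1_(~` B x d) y.
have KE y : K y = if (d <= rho x y)%R then (rho x y `^ lam)^-1 else 0.
  rewrite /K indicE; case: ifPn => h.
    by rewrite mem_set ?mulr1 ?powRN// /metric_ball/=; apply/negP; rewrite -leNgt.
  by rewrite memNset ?mulr0//= => /(_ _); apply; rewrite /metric_ball/= ltNge.
have mK : measurable_fun [set: T] K.
  apply: measurable_funM.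
    exact: (measurableT_comp (measurable_powR (- lam)) (measurable_rho x)).
  by apply: measurable_indic; exact: measurableC.
have K0 y : 0 <= K y by rewrite mulr_ge0 ?powR_ge0.
have := hoelder mu measurable_g mK p0 p'0 pp'.
rewrite Lnorm1 => hh.
have -> : (\int[mu]_y (if d <= rho x y then g y / rho x y `^ lam else 0)%:E =
    \int[mu]_y `|((g \* K) y)%:E|)%E.
  apply: eq_integral => y _; have gK0 : 0 <= g y * K y by rewrite mulr_ge0.
  rewrite gee0_abs ?lee_fin//; congr EFin; rewrite /= KE.
  by case: ifP => // _; rewrite mulr0.
apply: le_trans hh _.
rewrite EFinM; apply: lee_pmul => //; [exact: Lnorm_ge0|exact: Lnorm_ge0|].
rewrite unlock/=.

set b := (w * 2 ^+ n * _ / _).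
have hb : (\int[mu]_y (`|(K y)%:E| `^ p') <= b%:E)%E.
  rewrite (eq_integral (fun y => (if d <= rho x y then rho x y `^ (- (lam * p')) else 0)%:E)).
    exact: integral_far_kernel_le.
  move=> y _; rewrite gee0_abs ?lee_fin// poweR_EFin KE; congr EFin.
  by case: ifP => _; rewrite ?powR0 ?gt_eqF// -powRN -powRrM mulNr.
have i0 : (0 <= \int[mu]_y (`|(K y)%:E| `^ p'))%E.
  by apply: integral_ge0 => y _; rewrite poweR_ge0.
rewrite -poweR_EFin; apply: gt0_ler_poweR => //.
- by rewrite invr_ge0 ltW.
- by rewrite in_itv/= i0 leey.
- by rewrite in_itv/= leey andbT (le_trans i0).
Qed.

(** The constant of [integral_near_le] for M = 2 s^(1/p) w 3^n, the bound from [integral_ball_le],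
    without s^(1/p) and the power of the radius. It is independent of p. *)
Definition near_cst lam := 2 `^ lam * (2 * (w * 3 ^+ n)) / (1 - 2 `^ (- (n%:R - lam))).

(** The L^p' norm bound of the far kernel at radius 1. The root 1/p' outside the geometric factor is
    what limits its growth to q^(1/p'). *)
Definition far_cst lam p' :=
  (w * 2 ^+ n / (1 - 2 `^ (- (lam * p' - n%:R)))) `^ p'^-1.

Lemma near_cst_gt0 lam : 0 < lam < n%:R -> 0 < near_cst lam.
Proof.
move=> /andP[l0 ln]; have h : 0 < n%:R - lam by lra.
have := powR2N_lt1 h => h1.
by rewrite /near_cst divr_gt0 ?mulr_gt0 ?powR_gt0 ?exprn_gt0//; lra.
Qed.

Lemma riesz_potential_le x s lam p p' q c :
  1 < p -> 0 < p' -> p^-1 + p'^-1 = 1 -> 0 < lam < n%:R -> 0 < q ->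
  q^-1 = p^-1 - (n%:R - lam) / n%:R ->
  0 <= c -> ('N[mu]_p%:E[EFin \o g] <= c%:E)%E -> dyadic_max p x = s%:E ->
  (\int[mu]_y (g y / rho x y `^ lam)%:E <=
   ((near_cst lam + far_cst lam p') * s `^ q^-1 * c `^ (p * (n%:R - lam) / n%:R))%:E)%E.
Proof.
move=> p1 p'0 pp' /andP[l0 ln] q0 qE c0 hc Sx.
have n0 : 0 < n%:R :> R by lra.
have p0 : 0 < p by lra.
have p'E : p' = (1 - p^-1)^-1 by rewrite -[LHS]invrK; congr _^-1; lra.
have s0 : 0 <= s.
  by rewrite -lee_fin -Sx; exact: dyadic_max_ge0.
set al := n%:R - lam; have al0 : 0 < al by rewrite /al; lra.
(* After the root 1/p', this gives the far part the decay d^(-n/q). The near part grows like d^al,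
   and al + n/q = n/p turns the optimal exponents into p/q and al p/n. *)
have mE : lam * p' - n%:R = n%:R * p' / q.
  have -> : lam = n%:R - al by rewrite /al; lra.
  rewrite qE -/al.
  have h : p' * p^-1 = p' - 1.
    by rewrite (_ : p^-1 = 1 - p'^-1); [rewrite mulrBr mulr1 mulfV ?gt_eqF|lra].
  rewrite mulrBr -[n%:R * p' * p^-1]mulrA h.
  by field; rewrite gt_eqF.
have m0 : n%:R < lam * p'.
  by rewrite -subr_gt0 mE divr_gt0// mulr_gt0.
have E1 : al + n%:R / q = n%:R / p.
  by rewrite qE -/al; field; rewrite !gt_eqF.
have mI : measurable_fun [set: T] (fun y => g y / rho x y `^ lam).
  apply: measurable_funM => //.
  under eq_fun do rewrite -powRN.
  exact: (measurableT_comp (measurable_powR (- lam)) (measurable_rho x)).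
have I0 y : 0 <= g y / rho x y `^ lam by rewrite divr_ge0 ?powR_ge0.
have split_le d : 0 < d -> (\int[mu]_y (g y / rho x y `^ lam)%:E <=
    (near_cst lam * s `^ p^-1 * d `^ al +
     far_cst lam p' * c * d `^ (- (n%:R / q)))%:E)%E.
  move=> d0.
  have -> : (\int[mu]_y (g y / rho x y `^ lam)%:E =
     \int[mu]_y (if (rho x y < d)%R then g y / rho x y `^ lam else 0)%:E +
     \int[mu]_y (if (d <= rho x y)%R then g y / rho x y `^ lam else 0)%:E)%E.
    rewrite -ge0_integralD//.
    - apply: eq_integral => y _; rewrite -EFinD; congr EFin.
      by case: ltP => _; rewrite ?addr0 ?add0r.
    - by move=> y _; rewrite lee_fin; case: ifP.
    - apply/measurable_EFinP/measurable_fun_ifT => //.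
      exact: measurable_fun_ltr.
    - by move=> y _; rewrite lee_fin; case: ifP.
    - apply/measurable_EFinP/measurable_fun_ifT => //.
      exact: measurable_fun_ler.
  rewrite EFinD; apply: leeD.
    have -> : near_cst lam * s `^ p^-1 * d `^ al =
       2 `^ lam * (2 * s `^ p^-1 * (w * 3 ^+ n)) * d `^ (n%:R - lam) /
       (1 - 2 `^ (- (n%:R - lam))).
      by rewrite /near_cst /al; ring.
    apply: integral_near_le => //.
    - by rewrite l0.
    - by rewrite !mulr_ge0 ?powR_ge0 ?exprn_ge0// ltW.
    - move=> r r0.
      have -> : 2 * s `^ p^-1 * (w * 3 ^+ n) * r ^+ n =
        2 * s `^ p^-1 * (w * (3 * r) ^+ n) by rewrite exprMn; ring.
      exact: (integral_ball_le p0 Sx r0).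
  have -> : far_cst lam p' * c * d `^ (- (n%:R / q)) =
     c * (w * 2 ^+ n * d `^ (- (lam * p' - n%:R)) /
         (1 - 2 `^ (- (lam * p' - n%:R)))) `^ p'^-1.
    rewrite /far_cst mulrAC (mulrC _ c); congr (_ * _).
    have h : 0 < lam * p' - n%:R by lra.
    have h2 := powR2N_lt1 h.
    have -> : d `^ (- (n%:R / q)) = (d `^ (- (lam * p' - n%:R))) `^ p'^-1.
      by rewrite -powRrM mE; congr (_ `^ _); field; rewrite !gt_eqF.
    rewrite -powRM ?powR_ge0//; last first.
      by rewrite divr_ge0 ?mulr_ge0 ?exprn_ge0 ?(ltW w_gt0)//; lra.
    by congr (_ `^ _); ring.
  exact: (integral_far_le _ p0 p'0 pp' m0 d0 c0 hc).
have X0 : (0 <= \int[mu]_y (g y / rho x y `^ lam)%:E)%E.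
  by apply: integral_ge0 => y _; rewrite lee_fin.
apply: le_trans (optimise_two_powers X0 _ _ _ _ al0 _ split_le) _ => //.
- by apply/ltW/near_cst_gt0; rewrite l0.
- by rewrite powR_ge0.
- by rewrite powR_ge0.
- by rewrite divr_gt0.
rewrite E1 lee_fin -powRrM le_eqVlt; apply/orP; left; apply/eqP.
congr (_ * _ `^ _ * _ `^ _); field; rewrite !gt_eqF//.
Qed.

(* A bound c > 0 is used in place of the p-norm of g, which may vanish: then
   the constant in front of dyadic_max is nonzero, even where dyadic_max is +oo. *)
Lemma Lnorm_riesz_potential_le lam p p' q c :
  1 < p -> 0 < p' -> p^-1 + p'^-1 = 1 -> 0 < lam < n%:R -> 0 < q ->
  q^-1 = p^-1 - (n%:R - lam) / n%:R ->
  0 < c -> ('N[mu]_p%:E[EFin \o g] <= c%:E)%E ->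
  ('N[mu]_q%:E[(fun x => \int[mu]_y (g y / rho x y `^ lam)%:E)] <=
   ((near_cst lam + far_cst lam p') *
    (3 ^+ n * (2 `^ p / (1 - 2 `^ (- (p - 1))))) `^ q^-1 * c)%:E)%E.
Proof.
move=> p1 p'0 pp' lamn q0 qE c0 hc.
have p0 : 0 < p by lra.
have pn0 : p != 0 by rewrite gt_eqF.
have nz0 : 0 < n%:R :> R by lra.
set Z := near_cst lam + far_cst lam p'.
set Cp := 3 ^+ n * _.
set e := p * (n%:R - lam) / n%:R.
have Z0 : 0 < Z by rewrite ltr_wpDr ?powR_ge0// near_cst_gt0.
have Cp0 : 0 <= Cp.
  have p10 : 0 < p - 1 by lra.
  have := powR2N_lt1 p10 => h.
  by rewrite mulr_ge0 ?exprn_ge0// divr_ge0 ?powR_ge0//; lra.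
have k0 : 0 < (Z * c `^ e) `^ q by rewrite powR_gt0// mulr_gt0// powR_gt0.
have gp : (\int[mu]_x (g x `^ p)%:E <= (c `^ p)%:E)%E.
  have <- : ('N[mu]_p%:E[EFin \o g] `^ p = \int[mu]_x (g x `^ p)%:E)%E.
    rewrite (poweR_Lnorm mu (EFin \o g) pn0); apply: eq_integral => x _.
    by rewrite /= ger0_norm.
  rewrite -poweR_EFin; apply: gt0_ler_poweR => //; first exact: ltW.
    by rewrite in_itv/= leey andbT; exact: Lnorm_ge0.
  by rewrite in_itv/= leey andbT lee_fin ltW.
have ptw x : (`|\int[mu]_y (g y / rho x y `^ lam)%:E| `^ q <=
    ((Z * c `^ e) `^ q)%:E * dyadic_max p x)%E.
  have X0 : (0 <= \int[mu]_y (g y / rho x y `^ lam)%:E)%E.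
    by apply: integral_ge0 => y _; rewrite lee_fin divr_ge0 ?powR_ge0.
  rewrite gee0_abs//.
  have : (0 <= dyadic_max p x)%E by exact: dyadic_max_ge0.
  case E : (dyadic_max p x) => [s| |] // s0; last first.
    by rewrite gt0_muley ?lte_fin// leey.
  have h := riesz_potential_le p1 p'0 pp' lamn q0 qE (ltW c0) hc E.
  have -> : (((Z * c `^ e) `^ q)%:E * s%:E)%E = ((Z * s `^ q^-1 * c `^ e)%:E `^ q)%E.
    have Zc0 : 0 <= Z * c `^ e by rewrite mulr_ge0 ?powR_ge0// ltW.
    rewrite poweR_EFin mulrAC (powRM q Zc0 (powR_ge0 s _)) -(powRrM s).
    by rewrite mulVf ?gt_eqF// powRr1.
  apply: gt0_ler_poweR => //; first exact: ltW.
    by rewrite in_itv/= leey X0.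
  by rewrite in_itv/= leey andbT (le_trans X0 h).
rewrite unlock.
have hI : (\int[mu]_x `|\int[mu]_y (g y / rho x y `^ lam)%:E| `^ q <=
    ((Z * c `^ e) `^ q * (Cp * c `^ p))%:E)%E.
  apply: (@le_trans _ _ (\int[mu]_x (((Z * c `^ e) `^ q)%:E * dyadic_max p x))%E).
    by apply: ge0_le_integral_nonmeasurable => x //; exact: poweR_ge0.
  rewrite ge0_integralZl//; first last.
  - by rewrite lee_fin ltW.
  - by move=> x _; exact: dyadic_max_ge0.
  - exact: measurable_dyadic_max.
  rewrite (EFinM ((Z * c `^ e) `^ q)) lee_wpmul2l ?lee_fin ?(ltW k0)//.
  apply: le_trans (integral_dyadic_max_le p1) _.
  by rewrite (EFinM Cp) lee_wpmul2l ?lee_fin.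
have i0 : (0 <= \int[mu]_x `|\int[mu]_y (g y / rho x y `^ lam)%:E| `^ q)%E.
  by apply: integral_ge0 => x _; exact: poweR_ge0.
have -> : (Z * Cp `^ q^-1 * c)%:E =
    (((Z * c `^ e) `^ q * (Cp * c `^ p))%:E `^ q^-1)%E.
  rewrite poweR_EFin; congr EFin.
  have Zc0 : 0 <= Z * c `^ e by rewrite mulr_ge0 ?powR_ge0// ltW.
  rewrite (powRM _ (powR_ge0 _ _) (mulr_ge0 Cp0 (powR_ge0 c p))).
  rewrite -(powRrM (Z * c `^ e)) mulfV ?gt_eqF// powRr1//.
  rewrite (powRM _ Cp0 (powR_ge0 c p)) -(powRrM c) mulrACA; congr (_ * _).
  have -> : c `^ e * c `^ (p / q) = c.
    rewrite -powRD ?(gt_eqF c0) ?implybT//.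
    suff -> : e + p / q = 1 by rewrite powRr1 ?ltW.
    by rewrite qE /e; field; rewrite !gt_eqF.
  by [].
apply: gt0_ler_poweR => //.
- by rewrite invr_ge0 ltW.
- by rewrite in_itv/= leey i0.
- by rewrite in_itv/= leey andbT (le_trans i0 hI).
Qed.
End hedberg.

(** * Lebesgue measure of cubes *)

Section cube.
Context (R : realType).
Local Notation RT := (measurableTypeR R).

Definition cube d (x : d.-tuple RT) (r : R) : set (d.-tuple RT) :=
  [set y | forall i, `|(tnth x i : R) - tnth y i| < r].

Lemma measurable_cube d (x : d.-tuple RT) r : measurable (cube x r).
Proof.
have -> : cube x r = \bigcap_(i in [set: 'I_d])
    ((fun y : d.-tuple RT => (tnth y i : R)) @^-1` [set z : R | `|(tnth x i : R) - z| < r]).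
  by apply/seteqP; split=> y /= h i => [_|]; exact: h.
apply: fin_bigcap_measurable => // i _.
rewrite -[X in measurable X]setTI; apply: measurable_tnth => //.
have -> : [set z : R | `|(tnth x i : R) - z| < r] = `](tnth x i : R) - r, (tnth x i : R) + r[%classic.
  apply/seteqP; split=> z /=; rewrite in_itv/= ltr_norml; lra.
exact: measurable_itv.
Qed.

(** Induction along the product construction: a cube is an interval of length 2r times a cube of one
    dimension less. In dimension 0 it is the whole one-point space, of Dirac mass 1. *)
Lemma borel_lebesgue_cube d (x : d.-tuple RT) r : 0 < r ->
  borel_lebesgue R d (cube x r) = (2 ^+ d * r ^+ d)%:E.
Proof.
move=> r0; elim: d x => [|d IH] x.
  rewrite /= diracE mem_set ?mulr1//= => i; by case: i.
case/tupleP: x => x0 x.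
rewrite /= /borel_lebesgue_step /pushforward.
pose I := `]x0 - r, x0 + r[%classic : set R.
have -> : @tuple_of_pair R d @^-1` cube [tuple of x0 :: x] r = I `*` cube x r.
  apply/seteqP; split=> -[a y]; rewrite /cube /tuple_of_pair/=.
    move=> h; split=> [|i] /=.
      by have := h ord0; rewrite !tnth0 /I/= in_itv/= ltr_norml; lra.
    by have := h (lift ord0 i); rewrite !tnthS.
  move=> [/= h0 h] i; case: (unliftP ord0 i) => [k ->|->].
    by rewrite !tnthS; exact: h.
  by rewrite !tnth0 ltr_norml; move: h0; rewrite /I/= in_itv/=; lra.
rewrite product_measure1E; [|exact: measurable_itv|exact: measurable_cube].
have hI : @lebesgue_measure R I = (2 * r)%:E.
  rewrite lebesgue_measure_itv/= lte_fin ifT; last lra.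
  by rewrite -EFinD; congr EFin; ring.
transitivity ((2 * r)%:E * (2 ^+ d * r ^+ d)%:E)%E.
  by congr (_ * _)%E; [exact: hI|exact: IH].
by rewrite -EFinM; congr EFin; rewrite !exprS; ring.
Qed.
End cube.

(** * The sup distance on Euclidean space as an instance of the abstract setting *)

Section sup_distance.
Context (R : realType) (d : nat).
Implicit Types x y z : euclid R d.

Definition sdist x y : R := \big[Num.max/0]_(i < d) `|Defs.coord x i - Defs.coord y i|.

Lemma sdist_ge0 x y : 0 <= sdist x y.
Proof. exact: bigmax_ge_id. Qed.

Lemma coord_le_sdist x y i : `|Defs.coord x i - Defs.coord y i| <= sdist x y.
Proof. exact: le_bigmax_cond. Qed.

Lemma sdist_lt x y r : 0 < r ->
  (sdist x y < r) <-> (forall i, `|Defs.coord x i - Defs.coord y i| < r).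
Proof.
move=> r0; split=> [h i|h]; first exact: le_lt_trans (coord_le_sdist x y i) h.
by apply: bigmax_lt => // i _; exact: h.
Qed.

Lemma sdist_refl x : sdist x x = 0.
Proof.
apply/le_anti; rewrite sdist_ge0 andbT.
by apply: bigmax_le => // i _; rewrite subrr normr0.
Qed.

Lemma sdist_sym x y : sdist x y = sdist y x.
Proof. by apply: eq_bigr => i _; rewrite distrC. Qed.

Lemma sdist_triangle x y z : sdist x z <= sdist x y + sdist y z.
Proof.
apply: bigmax_le => [|i _]; first by rewrite addr_ge0 ?sdist_ge0.
apply: le_trans (lerD (coord_le_sdist x y i) (coord_le_sdist y z i)).
by rewrite (le_trans _ (ler_normD _ _))// addrA subrK.
Qed.

Lemma sdist_le_edist x y : sdist x y <= Defs.edist x y.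
Proof.
apply: bigmax_le => [|i _]; first exact: sqrtr_ge0.
rewrite -sqrtr_sqr ler_sqrt; last by apply: sumr_ge0 => j _; exact: sqr_ge0.
by rewrite (bigD1 i)//= lerDl; apply: sumr_ge0 => j _; exact: sqr_ge0.
Qed.

Lemma sdist_eq0_edist x y : sdist x y = 0 -> Defs.edist x y = 0.
Proof.
move=> h; rewrite /Defs.edist big1 ?sqrtr0// => i _.
have := coord_le_sdist x y i; rewrite h normr_le0 => /eqP ->.
by rewrite expr0n.
Qed.

(** Preimages of Borel sets under a coordinate lie in the product sigma-algebra, which is contained
    in the Caratheodory one. *)
Lemma measurable_coord i : measurable_fun [set: euclid R d] (fun x => Defs.coord x i).
Proof.
move=> _ A mA; rewrite setTI; apply: caratheodory_measurable_mu_ext.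
by rewrite -[X in measurable X]setTI; exact: measurable_tnth.
Qed.

Lemma measurable_sdist x : measurable_fun [set: euclid R d] (sdist x).
Proof.
rewrite /sdist; elim: (index_enum _) => [|i s IH].
  by under eq_fun do rewrite big_nil; exact: measurable_cst.
under eq_fun do rewrite big_cons.
have mi : measurable_fun [set: euclid R d] (fun y => `|Defs.coord x i - Defs.coord y i|).
  apply: (measurableT_comp (@normr_measurable R setT)).
  apply: measurable_funB; first exact: measurable_cst.
  exact: measurable_coord.
exact: (measurable_maxr mi IH).
Qed.

Lemma measurable_edist x : measurable_fun [set: euclid R d] (Defs.edist x).
Proof.
have -> : Defs.edist x = (fun y => (\sum_(i < d) (Defs.coord x i - Defs.coord y i) ^+ 2) `^ 2^-1).
  apply/funext => y; rewrite powR12_sqrt//.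
  by apply: sumr_ge0 => i _; exact: sqr_ge0.
apply: (measurableT_comp (measurable_powR _)).
apply: measurable_sum => i; apply: measurable_funX.
apply: measurable_funB; first exact: measurable_cst.
exact: measurable_coord.
Qed.

Lemma measurable_sball x r : measurable (metric_ball sdist x r).
Proof.
have -> : metric_ball sdist x r = setT `&` (sdist x @^-1` `]-oo, r[%classic).
  by apply/seteqP; split=> y; rewrite /metric_ball/= in_itv/= => -[].
exact: (measurable_sdist x measurableT (measurable_itv _)).
Qed.

Lemma lebesgue_sball x r : 0 < r ->
  @lebesgue R d (metric_ball sdist x r) = (2 ^+ d * r ^+ d)%:E.
Proof.
move=> r0; rewrite -(borel_lebesgue_cube x r0).
have -> : metric_ball sdist x r = cube x r.
  by apply/seteqP; split=> y /(sdist_lt _ _ r0).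
by rewrite /lebesgue /completed_measure_extension measurable_mu_extE//; exact: measurable_cube.
Qed.

Definition rational_point k : euclid R d :=
  if @unpickle (d.-tuple rat) k is Some q then [tuple (ratr (tnth q i) : R) | i < d]
  else [tuple (0 : R) | i < d].

Lemma rational_point_dense x r : 0 < r -> exists k, sdist (rational_point k) x < r.
Proof.
move=> r0.
have h (i : 'I_d) : exists q : rat, `|ratr q - Defs.coord x i| < r.
  have /rat_in_itvoo[q] : Defs.coord x i - r < Defs.coord x i + r by lra.
  by rewrite in_itv/= => hq; exists q; rewrite ltr_norml; lra.
have [q hq] := choice h.
exists (pickle [tuple q i | i < d]); apply/sdist_lt => // i.
by rewrite /rational_point pickleK /Defs.coord !tnth_mktuple; exact: hq.
Qed.
End sup_distance.

(** * Comparison of the constants with the power factor of [zeta] *)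

Lemma hls_constant_le (R : realType) (d : nat) (w al : R) :
  (1 <= d)%N -> 1 <= w -> 0 < al < d%:R ->
  exists2 C : R, 0 < C & forall p p' q, 1 < p -> 0 < q ->
    q^-1 = p^-1 - al / d%:R -> p' = (1 - p^-1)^-1 ->
    (near_cst d w (d%:R - al) + far_cst d w (d%:R - al) p') *
    (3 ^+ d * (2 `^ p / (1 - 2 `^ (- (p - 1))))) `^ q^-1 <=
    C * (q ^+ 2 / (q - d%:R / (d%:R - al))) `^ (1 - al / d%:R).
Proof.
move=> d1 w1 /andP[al0 ald].
have D1 : 1 <= d%:R :> R by rewrite ler1n.
have l2 : 0 < ln 2 :> R by rewrite ln_gt0//; lra.
(* With this L, 1 + 1/(s ln 2) is at most L q as soon as s >= 1/q, and at most L p' for s = p -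
   1. *)
pose L : R := 1 + (ln 2)^-1.
have L1 : 1 <= L by rewrite /L lerDl invr_ge0 ltW.
pose A := near_cst d w (d%:R - al).
have A0 : 0 < A by apply: near_cst_gt0; lra.
pose b0 := w * 2 ^+ d * L.
pose k := 1 - al / d%:R.
pose q0 := d%:R / (d%:R - al).
have q00 : 0 < q0 by rewrite divr_gt0; lra.
have e2 : 1 <= 2 ^+ d :> R by rewrite exprn_ege1//; lra.
have e3 : 1 <= 3 ^+ d :> R by rewrite exprn_ege1//; lra.
have b01 : 1 <= b0 by rewrite /b0 !mulr_ege1.
have c1 : 1 <= 3 ^+ d * L by rewrite !mulr_ege1.
(* The first factor bounds the near and far constants, the second the maximal inequality, and the
   power of [q0] undoes the division by [q0] in [zE]. *)
exists ((A + b0) * (2 * (3 ^+ d * L)) * q0 `^ k).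
  by rewrite !mulr_gt0 ?powR_gt0//; lra.
move=> p p' q p1 qgt0 qE p'E.
have adgt0 : 0 < al / d%:R by rewrite divr_gt0//; lra.
have p0 : 0 < p by lra.
have pV0 : 0 < p^-1 by rewrite invr_gt0.
have pV1 : p^-1 < 1 by rewrite invf_lt1.
have qV0 : 0 < q^-1 by rewrite invr_gt0.
have qV1 : q^-1 < 1 by lra.
have q1 : 1 < q by rewrite -[q]invrK invf_gt1.
have p'1 : 1 <= p' by rewrite p'E -[leLHS]invr1 lef_pV2 ?posrE//; lra.
have p'V : p'^-1 = 1 - p^-1 by rewrite p'E invrK.
have p'V0 : 0 < p'^-1 by rewrite invr_gt0; lra.
have k0 : 0 < k by rewrite /k; lra.
(* Here s = d p'/q >= 1/q, so the geometric factor is at most L q. Since b0 and q are at least 1 and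
   1/p' <= k <= 1, the root is bounded by b0 q^k. *)
have farle : far_cst d w (d%:R - al) p' <= b0 * q `^ k.
  pose s := (d%:R - al) * p' - d%:R.
  have sE : s = d%:R * p' / q.
    have E : p' * p^-1 = p' - 1.
      by rewrite (_ : p^-1 = 1 - p'^-1); [rewrite mulrBr mulr1 mulfV ?gt_eqF//; lra|lra].
    rewrite /s qE mulrBr -[d%:R * p' * p^-1]mulrA E.
    by field; rewrite gt_eqF//; lra.
  have s0 : 0 < s by rewrite sE !mulr_gt0//; lra.
  have h1 := inv_1BpowR2N_le s0.
  have h2 : (s * ln 2)^-1 <= q / ln 2.
    rewrite invfM ler_wpM2r ?invr_ge0 ?(ltW l2)// sE invf_div ler_pdivrMr; last by rewrite mulr_gt0//; lra.
    by rewrite ler_peMr ?(ltW qgt0)// mulr_ege1.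
  have h3 : (1 - 2 `^ (- s))^-1 <= L * q.
    have LE : L * q = q + q / ln 2 by rewrite /L; ring.
    by apply: le_trans h1 _; rewrite LE; lra.
  have h4 := powR2N_lt1 s0.
  rewrite /far_cst -/s.
  apply: (@le_trans _ _ ((b0 * q) `^ p'^-1)).
    apply: ge0_ler_powR; rewrite ?nnegrE.
    - exact: ltW.
    - by rewrite divr_ge0 ?mulr_ge0//; lra.
    - by rewrite mulr_ge0//; lra.
    - have -> : b0 * q = w * 2 ^+ d * (L * q) by rewrite /b0; ring.
      by rewrite ler_wpM2l// mulr_ge0//; lra.
  rewrite powRM; [|lra|lra]; apply: ler_pM; rewrite ?powR_ge0//.
    by rewrite ler1_powR//; lra.
  by apply: ler_powR; [lra|rewrite /k; lra].
have Cple : (3 ^+ d * (2 `^ p / (1 - 2 `^ (- (p - 1))))) `^ q^-1 <=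
    2 * (3 ^+ d * L) * p' `^ k.
  have p10 : 0 < p - 1 by lra.
  have h1 := inv_1BpowR2N_le p10.
  have p'E2 : p' = 1 + (p - 1)^-1.
    by rewrite p'E; field; rewrite !gt_eqF//; lra.
  have h2 : (1 - 2 `^ (- (p - 1)))^-1 <= L * p'.
    apply: le_trans h1 _; rewrite invfM /L p'E2.
    have u0 : 0 < (p - 1)^-1 by rewrite invr_gt0.
    have v0 : 0 < (ln 2)^-1 :> R by rewrite invr_gt0.
    by have := mulr_gt0 u0 v0; lra.
  have h4 := powR2N_lt1 p10.
  have two0 := powR_ge0 2 p.
  apply: (@le_trans _ _ (((3 ^+ d * L) * 2 `^ p * p') `^ q^-1)).
    apply: ge0_ler_powR; rewrite ?nnegrE.
    - exact: ltW.
    - by rewrite mulr_ge0 ?divr_ge0//; lra.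
    - by rewrite !mulr_ge0//; lra.
    - have -> : 3 ^+ d * L * 2 `^ p * p' = 3 ^+ d * (2 `^ p * (L * p')) by ring.
      by rewrite ler_wpM2l ?ler_wpM2l//; lra.
  have c0 : 0 <= 3 ^+ d * L by lra.
  rewrite (powRM _ (mulr_ge0 c0 two0)); last lra.
  rewrite (powRM _ c0 two0).
  apply: ler_pM; rewrite ?mulr_ge0 ?powR_ge0//; last first.
    by apply: ler_powR => //; rewrite /k; lra.
  rewrite mulrC; apply: ler_pM; rewrite ?powR_ge0//; last first.
    by rewrite ler1_powR//; lra.
  (* The power 2^(p/q) is at most 2, because 1/q < 1/p. *)
  rewrite -powRrM -[leRHS]powRr1//; apply: ler_powR; first lra.
  rewrite ler_pdivrMr// mul1r -lef_pV2 ?posrE//; lra.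
have zE : q ^+ 2 / (q - q0) = q * p' / q0.
  have qV : q = (p^-1 - al / d%:R)^-1 by rewrite -qE invrK.
  have : q - q0 = q * q0 * p'^-1.
    have -> : q - q0 = q * q0 * (q0^-1 - q^-1) by field; rewrite !gt_eqF.
    by rewrite qE p'V /q0 invf_div; congr (_ * _); field; rewrite gt_eqF//; lra.
  by move=> ->; field; rewrite !gt_eqF//; lra.
rewrite -/q0 -/k zE.
have -> : (q * p' / q0) `^ k = q `^ k * p' `^ k / q0 `^ k.
  rewrite powRM ?invr_ge0 ?(ltW q00)//; last by rewrite mulr_ge0//; lra.
  rewrite powRM; [|lra|lra].
  by rewrite -[q0^-1]powR_inv1 ?(ltW q00)// -powRrM mulN1r powRN.
have qk0 : q0 `^ k != 0 by rewrite gt_eqF ?powR_gt0.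
have -> : (A + b0) * (2 * (3 ^+ d * L)) * q0 `^ k * (q `^ k * p' `^ k / q0 `^ k) =
  ((A + b0) * q `^ k) * (2 * (3 ^+ d * L) * p' `^ k) by field.
apply: ler_pM; rewrite ?powR_ge0//.
  by rewrite addr_ge0 ?powR_ge0 ?ltW.
(* The near constant [A] carries no power of q; it is absorbed through q^k >= 1. *)
rewrite mulrDl lerD// ler_peMr ?(ltW A0)//.
have := @ler_powR R q (ltW q1) 0 k (ltW k0).
by rewrite powRr0.
Qed.

(** * The Riesz potential on Euclidean space, and the theorem *)

Section euclidean.
Context (R : realType) (d : nat) (alpha : R).
Hypothesis alpha_bounds : 0 < alpha < d%:R.
Local Notation mu := (@lebesgue R d).

Lemma abse_riesz_le (f : euclid R d -> R) x : measurable_fun [set: euclid R d] f ->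
  (`|riesz alpha f x| <=
   \int[mu]_y (`|f y| / sdist x y `^ (d%:R - alpha))%:E)%E.
Proof.
move=> mf; have [a0 ad] := andP alpha_bounds.
have l0 : 0 < d%:R - alpha by lra.
have mk : measurable_fun [set: euclid R d]
    (fun y => (Defs.edist x y `^ (d%:R - alpha))^-1).
  under eq_fun do rewrite -powRN.
  exact: (measurableT_comp (measurable_powR _) (measurable_edist x)).
have mI : measurable_fun [set: euclid R d]
    (fun y => (f y / Defs.edist x y `^ (d%:R - alpha))%:E).
  by apply/measurable_EFinP; exact: (measurable_funM mf mk).
apply: le_trans (le_abse_integral mu measurableT mI) _.
apply: ge0_le_integral_nonmeasurable => y; first exact: abse_ge0.
rewrite abse_EFin lee_fin normrM ler_wpM2l//.
rewrite ger0_norm ?invr_ge0 ?powR_ge0//.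
(* The comparison of inverse powers needs positive distances. At distance 0 both distances vanish
   together, and both kernels take the default value 0. *)
have [s0|sn0] := eqVneq (sdist x y) 0.
  by rewrite s0 sdist_eq0_edist// powR0 ?gt_eqF.
have sp : 0 < sdist x y by rewrite lt_def sn0 sdist_ge0.
have ep : 0 < Defs.edist x y := lt_le_trans sp (sdist_le_edist x y).
rewrite lef_pV2 ?posrE ?powR_gt0// ge0_ler_powR ?nnegrE ?(ltW sp) ?(ltW ep) ?(ltW l0)//.
exact: sdist_le_edist.
Qed.

Lemma Lnorm_riesz_le p p' q c (f : euclid R d -> R) :
  1 < p -> 0 < p' -> p^-1 + p'^-1 = 1 -> 0 < q ->
  q^-1 = p^-1 - alpha / d%:R -> 0 < c ->
  measurable_fun [set: euclid R d] f ->
  ('N[mu]_p%:E[EFin \o f] <= c%:E)%E ->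
  ('N[mu]_q%:E[riesz alpha f] <=
   ((near_cst d (2 ^+ d) (d%:R - alpha) + far_cst d (2 ^+ d) (d%:R - alpha) p') *
    (3 ^+ d * (2 `^ p / (1 - 2 `^ (- (p - 1))))) `^ q^-1 * c)%:E)%E.
Proof.
move=> p1 p'0 pp' q0 qE c0 mf hc; have [a0 ad] := andP alpha_bounds.
pose g (y : euclid R d) := `|f y|.
have mg : measurable_fun [set: euclid R d] g.
  exact: (measurableT_comp (@normr_measurable R setT) mf).
have g0 y : 0 <= g y by exact: normr_ge0.
have w0 : 0 < 2 ^+ d :> R by rewrite exprn_gt0.
have hg : ('N[mu]_p%:E[EFin \o g] <= c%:E)%E.
  by rewrite -Lnorm_abse in hc.
have lamE : d%:R - (d%:R - alpha) = alpha by lra.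
have lamn : 0 < d%:R - alpha < d%:R by lra.
have qE' : q^-1 = p^-1 - (d%:R - (d%:R - alpha)) / d%:R by rewrite lamE.
apply: le_trans (Lnorm_riesz_potential_le w0 (@sdist_refl R d) (@sdist_ge0 R d)
  (@sdist_sym R d) (@sdist_triangle R d) (@measurable_sdist R d)
  (@measurable_sball R d) (@lebesgue_sball R d) (@rational_point_dense R d)
  mg g0 p1 p'0 pp' lamn q0 qE' c0 hg).
rewrite unlock; apply: gt0_ler_poweR.
- by rewrite invr_ge0 ltW.
- rewrite in_itv/= leey andbT; apply: integral_ge0 => x _; exact: poweR_ge0.
- rewrite in_itv/= leey andbT; apply: integral_ge0 => x _; exact: poweR_ge0.
- apply: ge0_le_integral_nonmeasurable => x; first exact: poweR_ge0.
  have hx := le_trans (abse_riesz_le x mf) (lee_abs _).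
  apply: gt0_ler_poweR (ltW q0) _ _ _ _ hx.
    by rewrite in_itv/= leey andbT; exact: abse_ge0.
  by rewrite in_itv/= leey andbT; exact: abse_ge0.
Qed.
End euclidean.

Theorem theorem1 (R : realType) (d : nat) (alpha a b : R) (psi : R -> R)
  (hd : (1 <= d)%N) (halpha : 0 < alpha < d%:R)
  (ha : 1 <= a) (hab : a < b) (hb : b <= d%:R / alpha)
  (hpsi : Psi a b psi) :
  exists C : R, 0 < C /\
    forall f : euclid R d -> R, GL `]a, b[ psi f ->
      (GLnorm (zeta_dom d alpha a b) (zeta d alpha psi) (riesz alpha f)
       <= C%:E * GLnorm `]a, b[ psi (EFin \o f))%E.
Proof.
have [a0 ad] := andP halpha.
have w1 : 1 <= 2 ^+ d :> R by rewrite exprn_ege1//; lra.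
have [C C0 hC] := hls_constant_le hd w1 halpha.
exists C; split=> // f [mf Gfin]; set G := GLnorm `]a, b[ psi _ in Gfin *.
have [_ psi0 _ _] := hpsi.
have GP p : p \in `]a, b[ -> ('N[@lebesgue R d]_p%:E[EFin \o f] <= (psi p)%:E * G)%E.
  move=> pab; have pp := psi0 _ pab.
  rewrite -lee_pdivrMl// muleC; apply: ereal_sup_ubound.
  by exists p.
(* The supremum runs over a nonempty set of exponents, witnessed by the midpoint, so it is not the
   value -oo of an empty supremum. *)
have G0 : (0 <= G)%E.
  have mab : (a + b) / 2 \in `]a, b[ by rewrite in_itv/=; apply/andP; split; lra.
  have := le_trans (Lnorm_ge0 _ _ _) (GP _ mab).
  by rewrite pmule_rge0// lte_fin psi0.
case: G G0 Gfin GP => [G G0 _ GP|_ //|//].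
rewrite lee_fin in G0.
apply: ge_ereal_sup => _ [q [q0q /andP[ap pb]] <-].
set p := d%:R * q / (d%:R + alpha * q) in ap pb.
have D1 : 1 <= d%:R :> R by rewrite ler1n.
have q0 : 0 < q by apply: lt_trans q0q; rewrite divr_gt0//; lra.
have aq : 0 < alpha * q by rewrite mulr_gt0.
have p1 : 1 < p by lra.
have pV : p^-1 = q^-1 + alpha / d%:R.
  by rewrite /p; field; rewrite !gt_eqF//; lra.
have qE : q^-1 = p^-1 - alpha / d%:R by lra.
have pV1 : p^-1 < 1 by rewrite invf_lt1//; lra.
have p'0 : 0 < (1 - p^-1)^-1 by rewrite invr_gt0; lra.
have pp' : p^-1 + (1 - p^-1)^-1^-1 = 1 by rewrite invrK; lra.
have pab : p \in `]a, b[ by rewrite in_itv/= ap pb.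
have psip := psi0 _ pab.
set F := (q ^+ 2 / (q - d%:R / (d%:R - alpha))) `^ (1 - alpha / d%:R).
have F0 : 0 < F.
  rewrite powR_gt0// divr_gt0 ?exprn_gt0//; lra.
have zE : zeta d alpha psi q = F * psi p by [].
have z0 : 0 < F * psi p by rewrite mulr_gt0.
(* [Lnorm_riesz_le] asks for a strictly positive bound on the p-norm, while [psi p * G] is 0 when G
   = 0. The excess [e / (C * F)] becomes exactly [e] after multiplication by [C * F]. *)
rewrite zE muleC lee_pdivrMl// -EFinM; apply/lee_addgt0Pr => e e0.
have c0 : 0 < psi p * G + e / (C * F) by rewrite ltr_wpDl ?mulr_ge0 ?divr_gt0 ?mulr_gt0 ?(ltW psip).
have hc : ('N[@lebesgue R d]_p%:E[EFin \o f] <= (psi p * G + e / (C * F))%:E)%E.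
  apply: le_trans (GP _ pab) _; rewrite -EFinM lee_fin lerDl.
  by rewrite divr_ge0 ?mulr_ge0 ?ltW.
apply: le_trans (Lnorm_riesz_le halpha p1 p'0 pp' q0 qE c0 mf hc) _.
rewrite -EFinD lee_fin.
apply: (@le_trans _ _ (C * F * (psi p * G + e / (C * F)))).
  by rewrite ler_wpM2r ?(ltW c0)//; apply: hC.
rewrite le_eqVlt; apply/orP; left; apply/eqP.
by field; rewrite !gt_eqF.
Qed.
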